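(* For $j=1,\dots,r$ let $d_j\ge1$, $n_j=d_j+1$, and let $M_j$ be a free abelian group of rank $d_j$ generated by $v_{j1},\dots,v_{jn_j}$ with the single relation $v_{j1}+\dots+v_{jn_j}=0$; let $M=M_1\oplus\dots\oplus M_r$, $d=d_1+\dots+d_r$, $\Delta=\mathrm{conv}\{v_{ji}\}\subset M_{\mathbb R}$ (reflexive) and $$f(t)=1-\sum_{j=1}^r\sum_{i=1}^{n_j}a_{ji}t^{v_{ji}}.$$ For a monomial $x^k=\prod_{j,i}x_{ji}^{k_{ji}}$ of degree $d$ in variables $x_{ji}$ ($1\le i\le n_j$, $1\le j\le r$), with $k_j=\sum_ik_{ji}$, let $R_{x^k}=(-1)^d\mathrm{Res}_f\big(t_0^d\prod_{j,i}(a_{ji}t^{v_{ji}})^{k_{ji}}\big)$. Put $u_j=n_j^{n_j}a_{j1}\cdots a_{jn_j}$. Then $R_{x^k}$ is the rational function of $u_1,\dots,u_r$ $$R_{x^k}(u)=n_1^{d_1-k_1-1}\cdots n_r^{d_r-k_r-1}\ \mathrm{tr}_{L/K}\left(\frac1{z_1^{d_1-k_1}\cdots z_r^{d_r-k_r}(1-z_1-\dots-z_r)}\right),$$ where $K=\mathbb C(u_1,\dots,u_r)$, $L=K(z_1,\dots,z_r)$ with $z_j^{n_j}=u_j$, and $\mathrm{tr}_{L/K}(g)=\sum g(z_1,\dots,z_r)$ summed over all $n_1\cdots n_r$ solutions of $z_j^{n_j}=u_j$ ($1\le j\le r$).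
   Context: For a reflexive $d$-dimensional lattice polytope $\Delta\subset M_{\mathbb R}$, $S_\Delta=\bigoplus_kS^k_\Delta\subset\mathbb C[t_0,t^{\pm1}]$ with $S^k_\Delta$ spanned by $t_0^kt^m$, $m\in k\Delta\cap M$. For a Laurent polynomial $f$ supported in $\Delta$ put $f_i=t_i\partial f/\partial t_i$, $F_0=t_0f$, $F_i=t_0f_i$; for $\Delta$-regular $f$ (i.e. $F_0,\dots,F_d$ regular in $S_\Delta$) let $H'_f=t_0^d\det M_f$, $M_f$ the $(d+1)\times(d+1)$ matrix with first row and first column $(f,f_1,\dots,f_d)$ and $(i,j)$-entry $t_i\partial f_j/\partial t_i$ for $1\le i,j\le d$. The toric residue $\mathrm{Res}_f:S^d_\Delta\to\mathbb C$ is the linear map vanishing on $\sum_iF_iS^{d-1}_\Delta$ with $\mathrm{Res}_f(H'_f)=\mathrm{Vol}(\Delta)$ ($d!$ times Euclidean volume); it is a rational function of the coefficients $a_{ji}$. *)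

(* Defs.v *)
From HB Require Import structures.
From mathcomp Require Import all_boot all_order all_fingroup all_algebra.
From mathcomp Require Import reals.
From mathcomp.real_closed Require Import complex.

Set Implicit Arguments.
Unset Strict Implicit.
Unset Printing Implicit Defensive.

Import Order.TTheory GRing.Theory Num.Theory.
Local Open Scope ring_scope.

(* The lattice M = M_1 (+) ... (+) M_r.  M_j = Z^{n_j}/(1,...,1) has   *)
(* Z-basis v_{j1},...,v_{jd_j}; v_{jn_j} = -(v_{j1}+...+v_{jd_j}).     *)
(* Coordinates of M are indexed by Tidx dd = {(j,i) : i < d_j}, so     *)
(* M = Z^{Tidx dd} and d = #|Tidx dd| = \sum_j d_j.                    *)
(* Here d_j = dd j, n_j = (dd j).+1, vertices indexed by Vidx dd.      *)

Definition Tidx (r : nat) (dd : 'I_r -> nat) : finType := {j : 'I_r & 'I_(dd j)}.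
Definition Vidx (r : nat) (dd : 'I_r -> nat) : finType := {j : 'I_r & 'I_(dd j).+1}.
Definition Lat (r : nat) (dd : 'I_r -> nat) := {ffun Tidx dd -> int}.

Definition dtot (r : nat) (dd : 'I_r -> nat) : nat := (\sum_(j < r) dd j)%N.

Definition vert (r : nat) (dd : 'I_r -> nat) (v : Vidx dd) : Lat dd :=
  [ffun x : Tidx dd =>
     if tag x == tag v then
       (if val (tagged v) == dd (tag v) then -1
        else if val (tagged x) == val (tagged v) then 1 else 0)
     else 0].

(* m lies in k*Delta, Delta = conv{v_ji}: m is a nonnegative combination
   of the vertices with total weight k (convex coefficients taken rational,
   which for the rational point m and rational vertices is equivalent) *)
Definition inKDelta (r : nat) (dd : 'I_r -> nat) (k : nat) (m : Lat dd) : Prop :=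
  exists lam : {ffun Vidx dd -> rat},
    (forall v, 0 <= lam v) /\ \sum_v lam v = k%:R /\
    (forall x, (m x)%:~R = \sum_v lam v * (vert v x)%:~R).

Definition latcount (r : nat) (dd : 'I_r -> nat) (k n : nat) : Prop :=
  exists s : seq (Lat dd), uniq s /\ (forall m, m \in s <-> inKDelta k m)
                           /\ size s = n.

(* V is the Euclidean volume of Delta (Jordan content: the limit of
   #(Delta \cap (1/N) M) / N^d as N -> oo) *)
Definition EuclVolDelta (r : nat) (dd : 'I_r -> nat) (V : rat) : Prop :=
  forall eps : rat, 0 < eps -> exists N0 : nat, forall N n : nat,
    (N0 <= N)%N -> (0 < N)%N -> latcount dd N n ->
    `| n%:R / (N%:R ^+ dtot dd) - V | < eps.

(* Elements of C[t_0, t^{+-1}] as formal finite sums: a list of terms  *)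
(* (c, (k, m)) standing for c t_0^k t^m.  Two lists denote the same    *)
(* Laurent polynomial iff they have the same coefficients (lequiv).    *)

Definition LP (C : fieldType) (r : nat) (dd : 'I_r -> nat) :=
  seq (C * (nat * Lat dd)).

Section LaurentOps.
Context {C : fieldType} {r : nat} {dd : 'I_r -> nat}.

Definition lcoef (p : LP C dd) (e : nat * Lat dd) : C :=
  \sum_(x <- p | x.2 == e) x.1.

Definition lequiv (p q : LP C dd) : Prop := forall e, lcoef p e = lcoef q e.

Definition lone : LP C dd := [:: (1, (0%N, 0))].

Definition lmul (p q : LP C dd) : LP C dd :=
  [seq (x.1 * y.1, ((x.2.1 + y.2.1)%N, x.2.2 + y.2.2)) | x <- p, y <- q].

Definition lscale (c : C) (p : LP C dd) : LP C dd :=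
  [seq (c * x.1, x.2) | x <- p].

Definition lt0pow (k : nat) (p : LP C dd) : LP C dd :=
  [seq (x.1, ((x.2.1 + k)%N, x.2.2)) | x <- p].

Definition ltheta (i : Tidx dd) (p : LP C dd) : LP C dd :=
  [seq (x.1 * (((x.2.2 : Lat dd) : {ffun Tidx dd -> int}) i)%:~R, x.2) | x <- p].

Definition inS (p : LP C dd) : Prop :=
  forall x, x \in p -> inKDelta x.2.1 x.2.2.

(* linear functional on the degree-d part, given by its values
   rho m = Res(t_0^d t^m) on the basis *)
Definition lapply (rho : Lat dd -> C) (p : LP C dd) : C :=
  \sum_(x <- p) x.1 * rho x.2.2.

(* Leibniz determinant of a matrix with entries in C[t_0,t^{+-1}],
   rows/columns indexed by option (Tidx dd) = {0,1,...,d} *)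
Definition ldet (A : option (Tidx dd) -> option (Tidx dd) -> LP C dd) : LP C dd :=
  flatten [seq lscale ((-1) ^+ odd_perm s)
                 (foldr lmul lone [seq A x (s x) | x <- enum {: option (Tidx dd)}])
          | s <- enum {perm option (Tidx dd)}].

End LaurentOps.

Section ToricResidue.
Context {C : fieldType} {r : nat} {dd : 'I_r -> nat}.
Variable a : forall j : 'I_r, 'I_(dd j).+1 -> C.

Definition polyF : LP C dd :=
  (1, (0%N, 0)) :: [seq (- @a (tag v) (tagged v), (0%N, vert v)) | v <- enum {: Vidx dd}].

(* F_0 = t_0 f, F_i = t_0 f_i ; index None is 0 *)
Definition Fgen (i : option (Tidx dd)) : LP C dd :=
  lt0pow 1 (match i with None => polyF | Some t => ltheta t polyF end).

Definition Mf (i j : option (Tidx dd)) : LP C dd :=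
  match i, j with
  | None, None => polyF
  | None, Some t => ltheta t polyF
  | Some s, None => ltheta s polyF
  | Some s, Some t => ltheta s (ltheta t polyF)
  end.

Definition Hprime : LP C dd := lt0pow (dtot dd) (ldet Mf).

Definition Fseq : seq (LP C dd) := [seq Fgen i | i <- enum {: option (Tidx dd)}].

Definition inIdealk (k : nat) (p : LP C dd) : Prop :=
  exists hs : nat -> LP C dd, (forall l, inS (hs l)) /\
    lequiv p (flatten [seq lmul (nth [::] Fseq l) (hs l) | l <- iota 0 k]).

Definition DeltaRegular : Prop :=
  forall k, (k < size Fseq)%N -> forall g, inS g ->
    inIdealk k (lmul (nth [::] Fseq k) g) -> inIdealk k g.

(* rho represents the toric residue Res_f : S^d_Delta -> C, where Vol(Delta)
   = d! * V and V is the Euclidean volume of Delta *)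
Definition IsToricResidue (V : rat) (rho : Lat dd -> C) : Prop :=
  (forall m, ~ inKDelta (dtot dd) m -> rho m = 0) /\
  (forall (i : option (Tidx dd)) (g : LP C dd), inS g ->
      (forall x, x \in g -> x.2.1 = (dtot dd).-1) ->
      lapply rho (lmul (Fgen i) g) = 0) /\
  lapply rho Hprime = ((dtot dd)`!)%:R * ratr V.

Definition Rmono (k : forall j : 'I_r, 'I_(dd j).+1 -> nat) (rho : Lat dd -> C) : C :=
  (-1) ^+ dtot dd *
  lapply rho [:: (\prod_(v : Vidx dd) @a (tag v) (tagged v) ^+ k (tag v) (tagged v),
                  (dtot dd, \sum_(v : Vidx dd) vert v *~ (k (tag v) (tagged v))%:Z))].

Definition uvar (j : 'I_r) : C :=
  ((dd j).+1)%:R ^+ (dd j).+1 * \prod_(i < (dd j).+1) @a j i.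

End ToricResidue.

(* Main.v *)
Require Import Defs.
From HB Require Import structures.
From mathcomp Require Import all_boot all_order all_fingroup all_algebra.
From mathcomp Require Import reals.
From mathcomp.real_closed Require Import complex.
From mathcomp Require Import zify ring lra.

(** Write [X_ji = a_ji t^(v_ji)].  Modulo the [F_i] with [i >= 1] the [X_ji] of one
    block [j] coincide, and [prod_i X_ji = prod_i a_ji]; so a functional on
    [S^d] killing these [F_i] is a function of the block degrees, and finite Fourier
    inversion writes it as [sum_c w_c ev_c], with [c] running over the
    [n_1 ... n_r] critical points of [f], where [X_ji = y_j := z_j / n_j].
    Vanishing on [F_0 S^(d-1)] kills every Fourier coefficient of [w_c f(c)] except the
    top one, whence [w_c = lambda / (f(c) prod_j y_j^(d_j))].  The constant [lambda]
    is read off from [H'_f], whose value at [c] is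
    [f(c) prod_j n_j (- y_j)^(d_j)], and from [Vol(Delta) = n_1 ... n_r]. *)

Set Implicit Arguments.
Unset Strict Implicit.
Unset Printing Implicit Defensive.

Import Order.TTheory GRing.Theory Num.Theory.
Local Open Scope ring_scope.

(** * Finite Fourier inversion *)

(** Exponents and points match: by prod_i X_ji = prod_i a_ji every block degree reduces to 0 <= e_j
    <= d_j, and there are as many such exponent vectors as choices of one root y_j per block.
    Exactly one of these vectors, (d_1,...,d_r), has degree d; below degree d the relation F_0
    applies, so a single moment stays free.

    The expansion in evaluations is available only on monomials of degree at most d in the X_ji,
    whereas expanding the determinant in H'_f gives products of d+1 terms of f. Since M_f is a sum
    of rank-one matrices, one per term of f, products with a repeated term cancel; a product of
    distinct terms can be rewritten in degree at most d.

    At c, M_f is a diagonal matrix times 1 + U U^T, with U the incidence matrix of coordinates and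
    blocks, and Sylvester's identity leaves the diagonal r x r matrix of the n_j. The same number
    n_1 ... n_r is the volume, because half-open simplices indexed by the same box partition the
    lattice points of k Delta. Hence lambda = (-1)^d / (n_1 ... n_r), whose sign cancels the one in
    R. *)

Lemma bigA_distr_dffun (K : comPzRingType) (I : finType) (T_ : I -> finType)
    (F : forall i, T_ i -> K) :
  \prod_i \sum_(x : T_ i) F i x =
  \sum_(c : {dffun forall i : I, T_ i}) \prod_i F i (c i).
Proof.
rewrite (reindex (@dffun_of_fprod I T_)) /=; last first.
  exact/onW_bij/dffun_of_fprod_bij.
transitivity (\sum_(t : fprod T_) \prod_i [ffun x : T_ i => F i x] (t i)).
  rewrite (big_fprod 1 +%R (fun i => [ffun x : T_ i => F i x])).
  rewrite -(bigA_distr_big_dep (fun i => tagged_with T_ i)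
    (fun i => untag 0 [ffun x : T_ i => F i x])) /=; apply: eq_bigr => i _.
  rewrite (big_tag (fun i (x : T_ i) => F i x)); apply: eq_bigr => x.
  rewrite inE => /eqP e; rewrite /untag; case: eqP => // e'.
  by rewrite ffunE.
by apply: eq_bigr => t _; apply: eq_bigr => i _; rewrite !ffunE.
Qed.

Section RootsOrthogonality.
Context {K : numFieldType} {n : nat} (A : K) (y : 'I_n.+1 -> K).
Hypotheses (y_inj : injective y) (yA : forall i, y i ^+ n.+1 = A) (A0 : A != 0).

Let y0 i : y i != 0.
Proof. by apply: contraNneq A0 => yi0; rewrite -(yA i) yi0 expr0n. Qed.

(** For distinct roots the ratio is an (n+1)-th root of unity other than 1, so its geometric sum
    vanishes. *)
Lemma root_orthogonality (i i' : 'I_n.+1) :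
  \sum_(e < n.+1) y i ^+ e / y i' ^+ e = n.+1%:R *+ (i == i').
Proof.
have [<-|ne] := eqVneq i i'.
  under eq_bigr do rewrite divff ?expf_neq0//.
  by rewrite sumr_const card_ord.
under eq_bigr do rewrite -expr_div_n.
have ne1 : y i / y i' - 1 != 0.
  rewrite subr_eq0; apply: contra ne => /eqP h.
  by apply/eqP/y_inj; rewrite -[LHS](divfK (y0 i')) h mul1r.
apply/eqP; rewrite mulr0n -(mulrI_eq0 _ (mulfI ne1)) -subrX1.
by rewrite expr_div_n !yA divff// subrr.
Qed.

(** The previous relation says that two square matrices satisfy Y Z = 1; this one is Z Y = 1, so no
    primitive root of unity has to be chosen. *)
Lemma root_orthogonality_dual (e e' : 'I_n.+1) :
  \sum_(i < n.+1) y i ^+ e / y i ^+ e' = n.+1%:R *+ (e == e').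
Proof.
have n0 : n.+1%:R != 0 :> K by rewrite pnatr_eq0.
pose Y := \matrix_(i < n.+1, e < n.+1) y i ^+ e.
pose Z := \matrix_(e < n.+1, i < n.+1) (n.+1%:R^-1 / y i ^+ e).
have YZ : Y *m Z = 1%:M.
  apply/matrixP => i i'; rewrite !mxE.
  under eq_bigr do rewrite !mxE mulrCA.
  by rewrite -mulr_sumr root_orthogonality mulrnAr mulVf.
have /matrixP /(_ e' e) := mulmx1C YZ; rewrite !mxE => h.
rewrite eq_sym -[n.+1%:R]mulr1 -mulrnAr -h mulr_sumr; apply: eq_bigr => i _.
by rewrite !mxE -mulrA mulVKf// mulrC.
Qed.

End RootsOrthogonality.

Section BoxFourier.
Context {K : numFieldType} {r : nat} {dd : 'I_r -> nat}.
Variables (A : 'I_r -> K) (y : forall j : 'I_r, 'I_(dd j).+1 -> K).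
Hypotheses (y_inj : forall j, injective (@y j)) (A0 : forall j, A j != 0).
Hypothesis yA : forall j (i : 'I_(dd j).+1), y i ^+ (dd j).+1 = A j.

Local Notation box := {dffun forall j : 'I_r, 'I_(dd j).+1}.

Definition nprod : K := \prod_j (dd j).+1%:R.

Lemma nprod_neq0 : nprod != 0.
Proof. by apply/prodf_neq0 => j _; rewrite pnatr_eq0. Qed.

Lemma prod_natmul_eq (c c' : box) :
  \prod_j ((dd j).+1%:R *+ (c j == c' j)) = nprod *+ (c == c').
Proof.
have [<-|ne] := eqVneq c c'; first by apply: eq_bigr => j _; rewrite eqxx.
have [j hj] : exists j, c j != c' j.
  apply/existsP; rewrite -negb_forall; apply: contra ne => /forallP h.
  by apply/eqP/ffunP => j; apply/eqP.
by rewrite (bigD1 j)//= (negPf hj) mul0r.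
Qed.

Lemma box_orthogonality (c c' : box) :
  \sum_(e : box) \prod_j (y (c j) ^+ e j / y (c' j) ^+ e j) = nprod *+ (c == c').
Proof.
rewrite -(bigA_distr_dffun (fun j (e : 'I_(dd j).+1) => y (c j) ^+ e / y (c' j) ^+ e)).
rewrite -prod_natmul_eq; apply: eq_bigr => j _.
exact: (root_orthogonality (@y_inj j) (@yA j) (A0 j)).
Qed.

Lemma box_orthogonality_dual (e e' : box) :
  \sum_(c : box) \prod_j (y (c j) ^+ e j / y (c j) ^+ e' j) = nprod *+ (e == e').
Proof.
rewrite -(bigA_distr_dffun (fun j (i : 'I_(dd j).+1) => y i ^+ e j / y i ^+ e' j)).
rewrite -prod_natmul_eq; apply: eq_bigr => j _.
exact: (root_orthogonality_dual (@y_inj j) (@yA j) (A0 j)).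
Qed.

(** Inverse finite Fourier transform: the weights on the points [c] whose moments over the box are
    [T]. *)
Definition boxweight (T : box -> K) (c : box) : K :=
  nprod^-1 * \sum_(e : box) T e / \prod_j y (c j) ^+ e j.

Lemma boxweightK (T : box -> K) (e : box) :
  \sum_c boxweight T c * \prod_j y (c j) ^+ e j = T e.
Proof.
rewrite /boxweight.
under eq_bigr do rewrite -mulrA mulr_suml.
rewrite -mulr_sumr exchange_big /= (bigD1 e)//= [X in _ + X]big1 => [|e' ne].
  under eq_bigr do rewrite -mulrA [_^-1 * _]mulrC -prodf_div.
  by rewrite -mulr_sumr box_orthogonality_dual eqxx addr0 mulrCA mulVf ?mulr1 ?nprod_neq0.
under eq_bigr do rewrite -mulrA [_^-1 * _]mulrC -prodf_div.
by rewrite -mulr_sumr box_orthogonality_dual eq_sym (negPf ne) mulr0.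
Qed.

(** Expanding [g] from its moments by [box_orthogonality], only the term of the exponent [top]
    survives. *)
Lemma box_inversion_top (g : box -> K) (top : box) :
    (forall e : box, e != top -> \sum_c g c * \prod_j y (c j) ^+ e j = 0) ->
  forall c, g c =
    nprod^-1 * (\sum_c' g c' * \prod_j y (c' j) ^+ top j) / \prod_j y (c j) ^+ top j.
Proof.
move=> gz c.
transitivity (nprod^-1 * \sum_(e : box) (\sum_c' g c' * \prod_j y (c' j) ^+ e j) /
    \prod_j y (c j) ^+ e j); last first.
  rewrite (bigD1 top)//= [X in _ + X]big1 ?addr0 ?mulrA// => e ne.
  by rewrite gz// mul0r.
under eq_bigr do rewrite mulr_suml.
rewrite exchange_big /= (bigD1 c)//= [X in _ + X]big1 => [|c' ne].
  under eq_bigr do rewrite -mulrA -prodf_div.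
  by rewrite -mulr_sumr box_orthogonality eqxx addr0 mulrCA mulVf ?mulr1 ?nprod_neq0.
under eq_bigr do rewrite -mulrA -prodf_div.
by rewrite -mulr_sumr box_orthogonality (negPf ne) mulr0.
Qed.

End BoxFourier.

Arguments nprod {K r} dd.

(** * Determinants indexed by a finite type *)

(** The Leibniz sum in the shape of [ldet], whose rows are indexed by [option (Tidx dd)]; [fdetE]
    links it to [\det]. *)
Definition fdet (K : comPzRingType) (X : finType) (M : X -> X -> K) : K :=
  \sum_(s : {perm X}) (-1) ^+ odd_perm s * \prod_x M x (s x).

Section Fdet.
Context {K : comPzRingType} {X : finType}.

(** Composing permutations with the transposition only yields that the determinant equals its
    opposite, hence the assumption of no 2-torsion. *)
Lemma fdet_eqrow (M : X -> X -> K) x1 x2 :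
    (forall z : K, z = - z -> z = 0) ->
  x1 != x2 -> M x1 =1 M x2 -> fdet M = 0.
Proof.
move=> K2 ne e12; apply: K2.
rewrite {1}/fdet (reindex_inj (mulgI (tperm x1 x2))) /= -sumrN.
apply: eq_bigr => s _; rewrite odd_permM odd_tperm ne /= signrN mulNr.
congr (- (_ * _)); rewrite (reindex_inj (@perm_inj _ (tperm x1 x2))) /=.
apply: eq_bigr => x _; rewrite permM tpermK.
by case: tpermP => [->|->|].
Qed.

Definition perm_enum (s : {perm 'I_#|X|}) : {perm X} :=
  perm (inj_comp (@enum_val_inj _ _)
    (inj_comp (@perm_inj _ s) (@enum_rank_inj X))).

Lemma perm_enumE s x : perm_enum s x = enum_val (s (enum_rank x)).
Proof. by rewrite permE. Qed.

Lemma perm_enumM s s' : perm_enum (s * s') = (perm_enum s * perm_enum s')%g.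
Proof. by apply/permP => x; rewrite permM !perm_enumE enum_valK permM. Qed.

Lemma perm_enum_tperm i i' :
  perm_enum (tperm i i') = tperm (enum_val i) (enum_val i').
Proof.
apply/permP => x; rewrite perm_enumE -{2}(enum_rankK x).
by rewrite inj_tperm//; exact: enum_val_inj.
Qed.

(** Transport along the enumeration is multiplicative and sends transpositions to transpositions, so
    parity follows along a factorisation of [s]. *)
Lemma odd_perm_enum s : odd_perm (perm_enum s) = odd_perm s.
Proof.
have [ts -> dts] := prod_tpermP s; elim: ts dts => [_|t ts IH /= /andP[dt dts]].
  rewrite !big_nil.
  have -> : perm_enum 1 = 1%g.
    by apply/permP => x; rewrite perm_enumE !perm1 enum_rankK.
  by rewrite !odd_perm1.
rewrite big_cons perm_enumM perm_enum_tperm !odd_permM !odd_tperm IH//.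
by rewrite (inj_eq (@enum_val_inj _ _)).
Qed.

Lemma fdetE (M : X -> X -> K) :
  fdet M = \det (\matrix_(i < #|X|, i' < #|X|) M (enum_val i) (enum_val i')).
Proof.
rewrite /fdet (reindex perm_enum) /=; last first.
  pose inv (s : {perm X}) := perm (inj_comp (@enum_rank_inj X)
    (inj_comp (@perm_inj _ s) (@enum_val_inj X X))).
  apply/onW_bij; exists inv => s; apply/permP => x.
    by rewrite permE /= perm_enumE !enum_valK.
  by rewrite perm_enumE permE /= !enum_rankK.
apply: eq_bigr => s _; rewrite odd_perm_enum; congr (_ * _).
rewrite (reindex (@enum_val X X)) /=; last exact/onW_bij/enum_val_bij.
by apply: eq_bigr => i _; rewrite mxE perm_enumE enum_valK.
Qed.

End Fdet.

(** Both products U W and W U of the block matrices are block lower triangular, with one diagonal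
    block the identity and the other one of the two sides. *)
Lemma sylvester_det (K : comPzRingType) m n (A : 'M[K]_(m, n)) (B : 'M_(n, m)) :
  \det (1%:M + A *m B) = \det (1%:M + B *m A).
Proof.
pose U := block_mx 1%:M A 0 1%:M.
pose W := block_mx 1%:M (- A) B 1%:M.
have UW : \det (U *m W) = \det (1%:M + A *m B).
  rewrite mulmx_block !mul1mx !mulmx1 !mul0mx !add0r addNr.
  by rewrite det_lblock det1 mulr1.
have WU : \det (W *m U) = \det (1%:M + B *m A).
  rewrite mulmx_block !mul1mx !mulmx1 !mulmx0 !addr0 subrr.
  by rewrite det_lblock det1 mul1r addrC.
by rewrite -UW -WU !det_mulmx mulrC.
Qed.

(** * Lattice points of the dilates of Delta *)

Lemma sum_ltn_ord n m : (m <= n)%N -> (\sum_(i < n) (i < m) = m)%N.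
Proof.
move=> /subnKC <-; rewrite big_split_ord /=.
rewrite (eq_bigr (fun=> 1%N)) => [|i _]; last by rewrite ltn_ord.
by rewrite sum1_card card_ord big1 ?addn0// => i _; rewrite ltnNge leq_addr.
Qed.

Lemma lift_ord_max n (i : 'I_n) : lift ord_max i = widen_ord (leqnSn n) i.
Proof. by apply: val_inj; rewrite /= /bump leqNgt ltn_ord. Qed.

Section Lattice.
Context {r : nat} {dd : 'I_r -> nat}.

Local Notation Vidx := (Vidx dd).
Local Notation Tidx := (Tidx dd).
Local Notation Lat := (Lat dd).
Local Notation box := {dffun forall j : 'I_r, 'I_(dd j).+1}.

Definition vtx (j : 'I_r) (i : 'I_(dd j).+1) : Vidx :=
  Tagged (fun j => 'I_(dd j).+1) i.

Definition basisv (x : Tidx) : Vidx := vtx (widen_ord (leqnSn _) (tagged x)).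

Lemma vtx_inj j : injective (@vtx j).
Proof. by move=> i i' /eqP; rewrite eq_Tagged /= => /eqP. Qed.

Lemma eq_vtx j j' (i : 'I_(dd j).+1) (i' : 'I_(dd j').+1) :
  (vtx i == vtx i') = (j == j') && (val i == val i').
Proof.
rewrite /vtx; have [e|ne] := eqVneq j j'.
  by subst j'; rewrite eq_Tagged.
by apply/negbTE; apply: contra ne => /eqP /(congr1 tag) /= ->.
Qed.

Lemma big_vtx (K : Type) (idx : K) (op : Monoid.com_law idx) (F : Vidx -> K) :
  \big[op/idx]_v F v =
  \big[op/idx]_(j < r) \big[op/idx]_(i < (dd j).+1) F (vtx i).
Proof.
rewrite (sig_big_dep xpredT (fun=> xpredT) (fun j i => F (@vtx j i))) /=.
by apply: eq_bigr => -[].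
Qed.

Lemma big_Tidx (K : Type) (idx : K) (op : Monoid.com_law idx) (F : Tidx -> K) :
  \big[op/idx]_x F x =
  \big[op/idx]_(j < r) \big[op/idx]_(i < dd j) F (Tagged (fun j => 'I_(dd j)) i).
Proof.
rewrite (sig_big_dep xpredT (fun=> xpredT)
  (fun j i => F (Tagged (fun j => 'I_(dd j)) i))) /=.
by apply: eq_bigr => -[].
Qed.

Lemma card_Tidx : #|{: Tidx}| = dtot dd.
Proof.
by rewrite card_tagged sumnE big_map big_enum; apply: eq_bigr => j _; rewrite card_ord.
Qed.

Lemma vertE (v : Vidx) (x : Tidx) :
  vert v x = (v == basisv x)%:R - (v == vtx (@ord_max (dd (tag x))))%:R.
Proof.
case: v x => j i [j' i']; rewrite ffunE /= /basisv /=.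
rewrite -/(vtx i) !eq_vtx /= [j' == j]eq_sym.
have [e|//] /= := eqVneq j j'; subst j'.
rewrite [_ == val i]eq_sym; have [ei|_] := eqVneq (i : nat) (dd j).
  by rewrite ei gtn_eqF// sub0r.
by rewrite subr0; case: eqP.
Qed.

(** With [g v] the term X_v, this is a logarithmic derivative: the relation F_x identifies X at the
    vertex [basisv x] with X at the last vertex of the same block. *)
Lemma sum_vert (K : pzRingType) (g : Vidx -> K) (x : Tidx) :
  \sum_v g v * (vert v x)%:~R = g (basisv x) - g (vtx (@ord_max (dd (tag x)))).
Proof.
transitivity (\sum_v g v * (v == basisv x)%:R -
              \sum_v g v * (v == vtx (@ord_max (dd (tag x))))%:R).
  rewrite -sumrB; apply: eq_bigr => v _.
  by rewrite vertE rmorphB /= mulrBr; do 2 case: (_ == _).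
have sumE w : \sum_v g v * (v == w)%:R = g w.
  rewrite (bigD1 w)//= eqxx mulr1 big1 ?addr0// => v /negbTE ->.
  by rewrite mulr0.
by rewrite !sumE.
Qed.

Definition lpt (l : Vidx -> nat) : Lat := \sum_v vert v *+ l v.

Lemma eq_lpt l l' : l =1 l' -> lpt l = lpt l'.
Proof. by move=> e; apply: eq_bigr => v _; rewrite e. Qed.

Lemma lptE l (x : Tidx) :
  lpt l x = (l (basisv x))%:Z - (l (vtx (@ord_max (dd (tag x)))))%:Z.
Proof.
rewrite -(sum_vert (fun v => (l v)%:Z)) /lpt sum_ffunE; apply: eq_bigr => v _.
by rewrite ffunMnE intz mulrC -mulr_natr natz.
Qed.

Lemma lptD l l' : lpt (fun v => l v + l' v)%N = lpt l + lpt l'.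
Proof. by rewrite /lpt -big_split; apply: eq_bigr => v _; rewrite mulrnDr. Qed.

Lemma lpt_delta w : lpt (fun v => (v == w) : nat) = vert w.
Proof.
rewrite /lpt (bigD1 w)//= eqxx mulr1n big1 ?addr0// => v /negbTE ->.
by rewrite mulr0n.
Qed.

Lemma lpt_block j : lpt (fun v => (tag v == j) : nat) = 0.
Proof. by apply/ffunP => x; rewrite lptE ffunE /= subrr. Qed.

(** The missing weight k - sum l is spread evenly over one block, whose vertices sum to zero, so the
    point does not move. *)
Lemma lpt_inKDelta k l : (0 < r)%N ->
  (\sum_v l v <= k)%N -> inKDelta k (lpt l).
Proof.
move=> r0 lek; pose j0 := Ordinal r0.
have n0 : (dd j0).+1%:R != 0 :> rat by rewrite pnatr_eq0.
pose s : rat := (k - \sum_v l v)%:R / (dd j0).+1%:R.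
exists [ffun v => (l v)%:R + s * (tag v == j0)%:R]; split=> [v|].
  by rewrite ffunE addr_ge0 ?mulr_ge0 ?ler0n// invr_ge0 ler0n.
split=> [|x].
  under eq_bigr do rewrite ffunE.
  rewrite big_split /= -natr_sum -mulr_sumr.
  have -> : \sum_v (tag (v : Vidx) == j0)%:R = (dd j0).+1%:R :> rat.
    rewrite big_vtx (bigD1 j0)//= [X in _ + X]big1 ?addr0 => [|j /negbTE ne].
      by rewrite ?eqxx sumr_const card_ord.
    by rewrite big1// => i _; rewrite ne.
  by rewrite divfK// natrB// addrC subrK.
by rewrite sum_vert !ffunE /= lptE rmorphB /=; ring.
Qed.

(** Normal form modulo the block relations v_j1 + ... + v_jn_j = 0. *)
Definition reduced (l : Vidx -> nat) := forall j, exists i, l (@vtx j i) = 0%N.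

(** Subtracting from the rational coefficients their minimum over each block keeps the point and
    lowers the weight. The results are natural numbers, because the coordinates of [m] are
    differences of coefficients within a block. *)
Lemma inKDelta_reduced k m : inKDelta k m ->
  exists l, [/\ reduced l, (\sum_v l v <= k)%N & m = lpt l].
Proof.
move=> [lam [lam0 [lamk lamm]]].
have dif x : (m x)%:~R = lam (basisv x) - lam (vtx (@ord_max (dd (tag x)))).
  by rewrite lamm sum_vert.
pose mi j : 'I_(dd j).+1 := [arg min_(i < ord0) lam (vtx i)]%O.
have miP j i : lam (vtx (mi j)) <= lam (@vtx j i).
  by rewrite /mi; case: arg_minP => // i' _; apply.
have inth j i : lam (@vtx j i) - lam (vtx (@ord_max (dd j))) \is a Num.int.
  case: (unliftP ord_max i) => [i'|] ->; last by rewrite subrr rpred0.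
  rewrite lift_ord_max.
  by have := dif (Tagged (fun j => 'I_(dd j)) i'); rewrite /basisv /= => <-; apply/intrP; eexists.
have nath v : lam v - lam (vtx (mi (tag v))) \is a Num.nat.
  rewrite natrEint subr_ge0; case: v => j i; rewrite miP andbT /=.
  have -> : lam (existT _ j i) - lam (vtx (mi j)) =
    (lam (vtx i) - lam (vtx (@ord_max (dd j)))) -
    (lam (vtx (mi j)) - lam (vtx (@ord_max (dd j)))) by rewrite /vtx /Tagged; ring.
  by rewrite rpredB ?inth.
pose l v := Num.trunc (lam v - lam (vtx (mi (tag v)))).
have lE v : (l v)%:R = lam v - lam (vtx (mi (tag v))) by rewrite truncnK.
exists l; split.
- by move=> j; exists (mi j); rewrite /l /= subrr truncn0.
- rewrite -(ler_nat rat) natr_sum -lamk; apply: ler_sum => v _.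
  by rewrite lE lerBlDr lerDl.
- apply/ffunP => x; apply: (@intr_inj rat).
  rewrite lptE rmorphB /= dif -!pmulrn !lE /=; ring.
Qed.

(** Equal points force l - l' to be constant on each block; both block minima being 0, the constant
    is 0. *)
Lemma lpt_reduced_inj l l' : reduced l -> reduced l' -> lpt l = lpt l' -> l =1 l'.
Proof.
move=> rl rl' e.
have key j (i : 'I_(dd j).+1) : (l (vtx i) + l' (vtx (@ord_max (dd j))) =
    l' (vtx i) + l (vtx (@ord_max (dd j))))%N.
  case: (unliftP ord_max i) => [i'|] ->; last by rewrite addnC.
  rewrite lift_ord_max.
  have := congr1 (fun m : Lat => m (Tagged (fun j => 'I_(dd j)) i')) e.
  by rewrite !lptE /basisv /=; lia.
case=> j i; have [i1 h1] := rl j; have [i2 h2] := rl' j.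
rewrite -[existT _ j i]/(vtx i).
have := key _ i; have := key _ i1; have := key _ i2; rewrite h1 h2; lia.
Qed.

Definition boxsum (c : box) : nat := (\sum_j c j)%N.

Lemma boxsum_le (c : box) : (boxsum c <= dtot dd)%N.
Proof. by apply: leq_sum => j _; rewrite -ltnS. Qed.

(* The half-open unimodular simplices: [c j] is the first vertex of the [j]-th
   block with coefficient zero, so the coefficients before it are shifted by 1. *)
Definition simplexpt (c : box) (b : {ffun Tidx -> nat}) (v : Vidx) : nat :=
  if unlift (c (tag v)) (tagged v) is Some i
  then (b (Tagged (fun j => 'I_(dd j)) i) + (i < c (tag v)))%N else 0%N.

Lemma simplexpt_lift c b j (i : 'I_(dd j)) :
  simplexpt c b (vtx (lift (c j) i)) =
  (b (Tagged (fun j => 'I_(dd j)) i) + (i < c j))%N.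
Proof. by rewrite /simplexpt /= liftK. Qed.

Lemma simplexpt_diag c b j : simplexpt c b (vtx (c j)) = 0%N.
Proof. by rewrite /simplexpt /= unlift_none. Qed.

Lemma simplexpt_reduced c b : reduced (simplexpt c b).
Proof. by move=> j; exists (c j); rewrite simplexpt_diag. Qed.

Lemma sum_simplexpt c b :
  (\sum_v simplexpt c b v = \sum_x b x + boxsum c)%N.
Proof.
rewrite big_vtx.
transitivity (\sum_j (\sum_(i < dd j) b (Tagged (fun j => 'I_(dd j)) i) + c j))%N.
  apply: eq_bigr => j _.
  rewrite (bigD1_ord (c j))//= simplexpt_diag add0n.
  under eq_bigr do rewrite simplexpt_lift.
  rewrite big_split /=; congr (_ + _)%N.
  by rewrite sum_ltn_ord// -ltnS.
by rewrite big_split /= big_Tidx.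
Qed.
End Lattice.

(** * Partition of the lattice points of k Delta into half-open simplices *)

Section LatticeCount.
Context {r : nat} {dd : 'I_r -> nat}.

Local Notation Vidx := (Vidx dd).
Local Notation Tidx := (Tidx dd).
Local Notation Lat := (Lat dd).
Local Notation box := {dffun forall j : 'I_r, 'I_(dd j).+1}.
Lemma simplexpt_gt0 (c : box) b j (i : 'I_(dd j).+1) :
  (i < c j)%N -> (0 < simplexpt c b (vtx i))%N.
Proof.
move=> ltic; case: (unliftP (c j) i) => [i' ei|ei]; last by rewrite ei ltnn in ltic.
move: (ltic); rewrite ei simplexpt_lift /= /bump => h.
suff -> : (i' < c j)%N by rewrite addn1.
by apply: leq_ltn_trans h; rewrite leq_addl.
Qed.

Lemma simplexpt_inj (c : box) b (c' : box) b' :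
  simplexpt c b =1 simplexpt c' b' -> c = c' /\ b = b'.
Proof.
move=> e.
have ec : c = c'.
  apply/ffunP => j; apply/val_inj => /=.
  have [h|h|//] := ltngtP (c j) (c' j).
    by have := simplexpt_gt0 b' h; rewrite -e simplexpt_diag.
  by have := simplexpt_gt0 b h; rewrite e simplexpt_diag.
subst c'; split=> //; apply/ffunP => -[j i].
by have := e (vtx (lift (c j) i)); rewrite !simplexpt_lift => /addIn.
Qed.

Lemma reduced_simplexpt (l : Vidx -> nat) :
  reduced l -> exists c b, l =1 simplexpt c b.
Proof.
move=> rl.
have rl' j : exists i, l (@vtx _ dd j i) == 0%N by have [i li] := rl j; exists i; rewrite li.
pose i0 j := xchoose (rl' j).
have [c cP] : exists c : box, forall j,
    l (vtx (c j)) = 0%N /\ forall i, l (@vtx _ dd j i) = 0%N -> (c j <= i)%N.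
  exists [ffun j => [arg min_(i < i0 j | l (vtx i) == 0%N) (i : nat)]] => j.
  rewrite ffunE; case: arg_minnP => [|i /eqP li0 imin]; first exact: (xchooseP (rl' j)).
  by split=> // i' /eqP; exact: imin.
pose b : {ffun Tidx -> nat} := [ffun x : Tidx =>
  (l (vtx (lift (c (tag x)) (tagged x))) - (tagged x < c (tag x)))%N].
exists c, b; case=> j i; rewrite -[existT _ j i]/(vtx i).
case: (unliftP (c j) i) => [i'|] ->; last by rewrite simplexpt_diag (cP j).1.
rewrite simplexpt_lift ffunE /= subnK//.
case: ltnP => // lti; rewrite lt0n; apply/eqP => /(cP j).2.
by rewrite /= /bump [(c j <= i')%N]leqNgt lti add0n leqNgt lti.
Qed.

(** The bound on the sum bounds every value by [n], so tuples of ordinals list everything and the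
    library count of such tuples applies. *)
Definition bounded_ffuns (n : nat) : seq {ffun Tidx -> nat} :=
  [seq [ffun x => val (tnth t (enum_rank x))] |
     t <- enum [set t : #|{: Tidx}|.-tuple 'I_n.+1 | (\sum_(i <- t) i <= n)%N]].

Lemma size_bounded_ffuns n : size (bounded_ffuns n) = 'C(dtot dd + n, dtot dd).
Proof.
by rewrite size_map -cardE card_partial_ord_partitions card_Tidx.
Qed.

Lemma bounded_ffuns_uniq n : uniq (bounded_ffuns n).
Proof.
rewrite map_inj_uniq ?enum_uniq// => t t' /ffunP e.
apply: eq_from_tnth => i; apply: val_inj.
by have := e (enum_val i); rewrite !ffunE enum_valK.
Qed.

Lemma mem_bounded_ffuns n b : (b \in bounded_ffuns n) = (\sum_x b x <= n)%N.
Proof.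
have reidx (F : {: Tidx} -> nat) : (\sum_x F x = \sum_(i < #|{: Tidx}|) F (enum_val i))%N.
  by rewrite (reindex (@enum_val Tidx Tidx))//; exact/onW_bij/enum_val_bij.
apply/mapP/idP => [[t] |le].
  rewrite mem_enum inE big_tuple => le ->; rewrite reidx; move: le.
  by under [X in _ -> (X <= _)%N]eq_bigr do rewrite ffunE enum_valK.
have bn x : (b x <= n)%N by apply: leq_trans le; rewrite (bigD1 x)//= leq_addr.
exists [tuple inord (b (enum_val i)) | i < #|{: Tidx}|].
  rewrite mem_enum inE big_tuple; apply: leq_trans le; rewrite reidx.
  by apply: leq_sum => i _; rewrite tnth_mktuple inordK// ltnS.
by apply/ffunP => x; rewrite ffunE tnth_mktuple enum_rankK /= inordK// ltnS.
Qed.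

Definition kDelta_points (k : nat) : seq Lat :=
  [seq lpt (simplexpt c b) | c <- [seq c <- enum {: box} | (boxsum c <= k)%N],
                             b <- bounded_ffuns (k - boxsum c)].

(** The Ehrhart function of Delta in h*-form: the simplex of [c] has [boxsum c] shifted coordinates
    and contributes the binomial of a unimodular simplex dilated by k - boxsum c. *)
Lemma latcount_kDelta k : (0 < r)%N ->
  latcount dd k (\sum_(c : box | (boxsum c <= k)%N)
                   'C(dtot dd + (k - boxsum c), dtot dd))%N.
Proof.
move=> r0; exists (kDelta_points k); split.
  apply: allpairs_uniq_dep => [|c _|].
  - by rewrite filter_uniq ?enum_uniq.
  - exact: bounded_ffuns_uniq.
  - move=> [c b] [c' b'] _ _ /= /lpt_reduced_inj.
    by move=> /(_ (simplexpt_reduced _ _) (simplexpt_reduced _ _)) /simplexpt_inj[-> ->].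
split=> [m|].
  split=> [/allpairsPdep[c [b [hc hb ->]]]|].
    apply: lpt_inKDelta => //; rewrite sum_simplexpt.
    move: hc hb; rewrite mem_filter mem_bounded_ffuns => /andP[hc _] hb.
    by rewrite -(subnK hc) leq_add2r.
  move=> /inKDelta_reduced[l [/reduced_simplexpt[c [b e]] lk ->]].
  move: lk; rewrite (eq_bigr _ (fun v _ => e v)) sum_simplexpt => lk.
  have hc : (boxsum c <= k)%N by apply: leq_trans lk; rewrite leq_addl.
  apply/allpairsPdep; exists c, b; split.
  - by rewrite mem_filter hc mem_enum.
  - by rewrite mem_bounded_ffuns leq_subRL// addnC.
  - exact: eq_lpt.
rewrite size_allpairs_dep sumnE big_map big_filter big_enum_cond /=.
by apply: eq_bigr => c _; rewrite size_bounded_ffuns.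
Qed.

(** * Asymptotics of the count and the Euclidean volume *)

Lemma bernoulli_upper (x : rat) d :
  0 <= x <= 1 -> (1 + x) ^+ d <= 1 + (2 ^ d)%:R * x.
Proof.
move=> /andP[x0 x1].
(* With the constant 2^d the induction step would fail near x = 1; 2^d - 1 makes it go through. *)
suff h : (1 + x) ^+ d <= 1 + ((2 ^ d)%:R - 1) * x by apply: le_trans h _; lra.
elim: d => [|d IH]; first by rewrite expr0 expn0 subrr mul0r addr0.
rewrite exprS expnS natrM.
have : 1 <= (2 ^ d)%:R :> rat by rewrite ler1n expn_gt0.
move: ((2 ^ d)%:R) IH => K IH K1.
have := ler_wpM2l (_ : 0 <= 1 + x) IH; rewrite addr_ge0// => /(_ isT) h.
apply: le_trans h _; rewrite -subr_ge0.
have -> : 1 + (2 * K - 1) * x - (1 + x) * (1 + (K - 1) * x) =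
  (K - 1) * (x * (1 - x)) by ring.
by rewrite !mulr_ge0 ?subr_ge0.
Qed.

Lemma bernoulli_lower (x : rat) d :
  0 <= x <= 1 -> 1 - (2 ^ d)%:R * x <= (1 - x) ^+ d.
Proof.
move=> /andP[x0 x1]; elim: d => [|d IH].
  by rewrite expr0 lerBlDr lerDl mulr_ge0.
rewrite exprS expnS natrM.
have : 1 <= (2 ^ d)%:R :> rat by rewrite ler1n expn_gt0.
move: ((2 ^ d)%:R) IH => K IH K1.
have := ler_wpM2l (_ : 0 <= 1 - x) IH; rewrite subr_ge0 => /(_ x1) h.
apply: le_trans h; rewrite -subr_ge0.
have -> : (1 - x) * (1 - K * x) - (1 - 2 * K * x) = x * (K - 1 + K * x) by ring.
apply: mulr_ge0 => //; apply: addr_ge0; first by rewrite subr_ge0.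
by apply: mulr_ge0 => //; exact: le_trans K1.
Qed.

(** The left-hand numerator is a falling factorial of d factors, all between k - d and k + d; the
    bound is uniform in the height [s]. *)
Lemma bin_asymp (d k s : nat) : (s <= d)%N -> (d <= k)%N -> (0 < k)%N ->
  `| (d`!)%:R * ('C(d + (k - s), d))%:R / k%:R ^+ d - 1 | <= (2 ^ d)%:R * (d%:R / k%:R) :> rat.
Proof.
move=> sd dk k0.
have k0' : 0 < k%:R :> rat by rewrite ltr0n.
have -> : (d`!)%:R * ('C(d + (k - s), d))%:R = ((d + (k - s)) ^_ d)%:R :> rat.
  by rewrite -natrM mulnC bin_ffact.
have up : ((d + (k - s)) ^_ d <= (k + d) ^ d)%N.
  rewrite ffact_prod -[X in (_ ^ X)%N]card_ord -prod_nat_const.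
  by apply: leq_prod => i _; lia.
have lo : ((k - d) ^ d <= (d + (k - s)) ^_ d)%N.
  rewrite ffact_prod -[X in (_ ^ X <= _)%N]card_ord -prod_nat_const.
  by apply: leq_prod => i _; have := ltn_ord i; lia.
have x01 : 0 <= (d%:R / k%:R : rat) <= 1.
  by rewrite divr_ge0 ?ler0n//= ler_pdivrMr// mul1r ler_nat.
rewrite ler_norml; apply/andP; split.
  rewrite lerBrDr addrC; apply: le_trans (bernoulli_lower d x01) _.
  rewrite ler_pdivlMr ?exprn_gt0// -exprMn mulrBl mul1r divfK ?gt_eqF//.
  by rewrite -natrB// -natrX ler_nat.
rewrite lerBlDr addrC; apply: le_trans (bernoulli_upper d x01).
rewrite ler_pdivrMr ?exprn_gt0// -exprMn mulrDl mul1r divfK ?gt_eqF//.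
by rewrite -natrD -natrX ler_nat.
Qed.

Lemma card_box : #|{: box}| = (\prod_j (dd j).+1)%N.
Proof.
rewrite (bij_eq_card (@fprod_of_dffun_bij _ _)) card_fprod.
by apply: eq_bigr => j _; rewrite card_ord.
Qed.

(** Each box contributes k^d / d! to leading order. Were the two sides to differ by D, a large k
    would place the same normalised count within |D|/2 of both. *)
Lemma EuclVolDeltaE (V : rat) : (0 < r)%N -> EuclVolDelta dd V ->
  ((dtot dd)`!)%:R * V = (\prod_j (dd j).+1)%N%:R.
Proof.
move=> r0 hV; rewrite -card_box; set d := dtot dd; set n := #|_|.
apply/eqP; rewrite -subr_eq0; apply: contraT => ne0.
set D := _ - _ in ne0.
have f0 : 0 < (d`!)%:R :> rat by rewrite ltr0n fact_gt0.
pose eps : rat := `|D| / 2 / (d`!)%:R.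
have D0 : 0 < `|D| by rewrite normr_gt0.
have eps0 : 0 < eps by rewrite /eps !divr_gt0.
have [N0 hN0] := hV _ eps0.
(* The error bounds of [bin_asymp] summed over the n boxes, with 1/k taken out. *)
pose B : rat := n%:R * (2 ^ d)%:R * d%:R.
have B0 : 0 <= B by rewrite /B !mulr_ge0 ?ler0n.
pose N1 := Num.bound (B * 2 / `|D|).
pose k := (N0 + N1 + d).+1.
have k0 : 0 < k%:R :> rat by rewrite ltr0n.
have {}hN0 := hN0 k _ _ _ (latcount_kDelta k r0).
have h1 := hN0 (leq_trans (leq_addr _ _) (leq_trans (leq_addr _ _) (leqnSn _))) isT.
set c := (\sum_(_ | _) _)%N in h1.
have dk : (d <= k)%N by rewrite /k; lia.
have h2 : `|(d`!)%:R * c%:R / k%:R ^+ d - n%:R| <= B / k%:R.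
  have -> : (d`!)%:R * c%:R / k%:R ^+ d - n%:R =
     \sum_(b : box) ((d`!)%:R * ('C(d + (k - boxsum b), d))%:R / k%:R ^+ d - 1) :> rat.
    rewrite sumrB sumr_const -/n -mulr_suml -mulr_sumr -natr_sum; congr (_ * _%:R / _ - _).
    by apply: eq_bigl => b; rewrite (leq_trans (boxsum_le b)).
  apply: le_trans (ler_norm_sum _ _ _) _.
  apply: le_trans (ler_sum _ (fun b _ => bin_asymp (boxsum_le b) dk isT)) _.
  by rewrite sumr_const -/n -[_ *+ n]mulr_natl /B !mulrA.
have h3 : B / k%:R < `|D| / 2.
  rewrite ltr_pdivrMr//.
  have : B * 2 / `|D| < k%:R.
    apply: lt_trans (archi_boundP _) _; first by rewrite divr_ge0 ?mulr_ge0.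
    by rewrite ltr_nat -/N1 /k; lia.
  by rewrite ltr_pdivrMr//; clear; move: (B) (k%:R) `|D| => B' k' D'; lra.
have h4 : `|(d`!)%:R * c%:R / k%:R ^+ d - (d`!)%:R * V| < `|D| / 2.
  have -> : (d`!)%:R * c%:R / k%:R ^+ d - (d`!)%:R * V =
            (d`!)%:R * (c%:R / k%:R ^+ d - V) by ring.
  by rewrite normrM gtr0_norm// mulrC -ltr_pdivlMr.
have : `|D| <= `|(d`!)%:R * c%:R / k%:R ^+ d - n%:R| +
               `|(d`!)%:R * c%:R / k%:R ^+ d - (d`!)%:R * V|.
  rewrite [`|_ - _ * V|]distrC; apply: le_trans (ler_normD _ _).
  by rewrite /D le_eqVlt; apply/orP; left; apply/eqP; congr `|_|; ring.
have := le_lt_trans h2 h3; move: h4; clear; lra.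
Qed.
End LatticeCount.

(** * Functionals vanishing on the ideal *)

Lemma val_eq_ord_max n (i : 'I_n.+1) : (val i == n) = (i == ord_max).
Proof. by []. Qed.

Lemma basisv_neq_max r (dd : 'I_r -> nat) (x : Tidx dd) j :
  basisv x != vtx (@ord_max (dd j)).
Proof.
case: x => j' i; rewrite /basisv eq_vtx /=; case: eqP => //= e; subst j'.
by rewrite ltn_eqF.
Qed.

Lemma basisv_inj r (dd : 'I_r -> nat) : injective (@basisv r dd).
Proof.
move=> [j i] [j' i'] /eqP; rewrite /basisv eq_vtx /= => /andP[/eqP e]; subst j'.
by move=> /eqP /val_inj ->.
Qed.

Section Functional.
Context {K : numFieldType} {r : nat} {dd : 'I_r -> nat}.
Variable a : forall j : 'I_r, 'I_(dd j).+1 -> K.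
Variable y : forall j : 'I_r, 'I_(dd j).+1 -> K.

Local Notation Vidx := (Vidx dd).
Local Notation Tidx := (Tidx dd).
Local Notation Lat := (Lat dd).
Local Notation box := {dffun forall j : 'I_r, 'I_(dd j).+1}.
Local Notation d := (dtot dd).

Definition av (v : Vidx) : K := a (tagged v).

Definition lsum (l : Vidx -> nat) (j : 'I_r) : nat :=
  (\sum_(i < (dd j).+1) l (vtx i))%N.

Definition conc (e : 'I_r -> nat) (v : Vidx) : nat :=
  if val (tagged v) == dd (tag v) then e (tag v) else 0%N.

Lemma sum_lsum l : (\sum_v l v = \sum_j lsum l j)%N.
Proof. by rewrite big_vtx. Qed.

Lemma lsum_conc e : lsum (conc e) =1 e.
Proof.
move=> j; rewrite /lsum (bigD1 ord_max)//= /conc /= eqxx big1 ?addn0// => i ne.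
by rewrite val_eq_ord_max (negPf ne).
Qed.

Lemma lsum_delta (w : Vidx) j : lsum (fun v => (v == w) : nat) j = (j == tag w).
Proof.
case: w => j' i'; rewrite -[existT _ j' i']/(vtx i') /lsum /=.
have [e|ne] := eqVneq j j'; last first.
  by rewrite big1// => i _; rewrite eq_vtx (negPf ne).
subst j'; rewrite (bigD1 i')//= eqxx big1// => i ne.
by rewrite (inj_eq (@vtx_inj _ _ _)) (negPf ne).
Qed.

Lemma lsum_block j0 j :
  lsum (fun v => (tag v == j0) : nat) j = ((j == j0) * (dd j).+1)%N.
Proof. by rewrite /lsum /= sum_nat_const card_ord mulnC. Qed.

Lemma lsumD l l' j : lsum (fun v => l v + l' v)%N j = (lsum l j + lsum l' j)%N.
Proof. by rewrite /lsum big_split. Qed.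

Lemma prod_lsum (F : 'I_r -> K) l :
  \prod_(v : Vidx) F (tag v) ^+ l v = \prod_j F j ^+ lsum l j.
Proof. by rewrite big_vtx; apply: eq_bigr => j _; rewrite /lsum expr_sum. Qed.

Lemma sum_delta (w : Vidx) : (\sum_v (v == w) = 1)%N.
Proof. by rewrite (bigD1 w)//= eqxx big1// => v /negbTE ->. Qed.

Section Van.
Variable rho : Lat -> K.
Hypotheses (r_gt0 : (0 < r)%N) (d_gt0 : (0 < d)%N).
Hypothesis rho_van : forall (i : option Tidx) (g : LP K dd), inS g ->
  (forall x, x \in g -> x.2.1 = d.-1) -> lapply rho (lmul (Fgen a i) g) = 0.

(** The value of the functional on t_0^d prod_v X_v^(l v); the total degree of [l] may be less than
    d, since 0 lies in Delta. *)
Definition tau (l : Vidx -> nat) : K := (\prod_v av v ^+ l v) * rho (lpt l).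

Lemma eq_tau l l' : l =1 l' -> tau l = tau l'.
Proof.
move=> e; rewrite /tau (eq_lpt e); congr (_ * _).
by apply: eq_bigr => v _; rewrite e.
Qed.

Lemma tau_delta l w :
  tau (fun v => l v + (v == w))%N =
  (\prod_v av v ^+ l v) * (av w * rho (vert w + lpt l)).
Proof.
rewrite /tau lptD lpt_delta mulrA addrC; congr (_ * _).
under eq_bigr do rewrite exprD.
rewrite big_split /=; congr (_ * _).
rewrite (bigD1 w)//= eqxx expr1 big1 ?mulr1// => v /negbTE ->.
by rewrite expr0.
Qed.

Lemma lapply_Fgen i l : (\sum_v l v < d)%N ->
  \sum_(x <- Fgen a i) x.1 * rho (x.2.2 + lpt l) = 0.
Proof.
move=> ld; rewrite -[RHS](rho_van i (g := [:: (1, (d.-1, lpt l))])).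
- rewrite /lapply /lmul big_allpairs_dep; apply: eq_bigr => x _.
  by rewrite big_seq1 mulr1.
- move=> x; rewrite inE => /eqP -> /=; apply: lpt_inKDelta => //.
  by rewrite -ltnS prednK.
- by move=> x; rewrite inE => /eqP ->.
Qed.

Lemma tau_swap l x : (\sum_v l v < d)%N ->
  tau (fun v => l v + (v == basisv x))%N =
  tau (fun v => l v + (v == vtx (@ord_max (dd (tag x)))))%N.
Proof.
move=> ld; rewrite !tau_delta; congr (_ * _); apply/eqP; rewrite -subr_eq0.
have := lapply_Fgen (Some x) ld.
rewrite /Fgen /lt0pow /ltheta big_map /polyF /= big_cons /= ffunE mulr0 mul0r add0r.
rewrite !big_map -enumT big_enum /= => h.
rewrite -(sum_vert (fun v => av v * rho (vert v + lpt l))) -oppr_eq0 -sumrN.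
by rewrite -[X in _ == X]h; apply/eqP/eq_bigr => v _; rewrite /av; ring.
Qed.

(** F_0 = t_0 (1 - sum_w X_w), so below degree d multiplication by sum_w X_w does not change the
    value. *)
Lemma tau_sum l : (\sum_v l v < d)%N ->
  tau l = \sum_w tau (fun v => l v + (v == w))%N.
Proof.
move=> ld; under eq_bigr do rewrite tau_delta.
rewrite -mulr_sumr /tau; congr (_ * _).
have := lapply_Fgen None ld.
rewrite /Fgen /lt0pow big_map /polyF big_cons /= mul1r add0r !big_map -enumT big_enum /=.
move/eqP; rewrite addr_eq0 => /eqP ->; rewrite -sumrN.
by apply: eq_bigr => v _; rewrite mulNr opprK.
Qed.

Lemma tau_block l j :
  tau (fun v => l v + (tag v == j))%N = (\prod_i @a j i) * tau l.
Proof.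
rewrite /tau lptD lpt_block addr0 mulrA; congr (_ * _).
under eq_bigr do rewrite exprD.
rewrite big_split /= mulrC; congr (_ * _).
rewrite big_vtx (bigD1 j)//= [X in _ * X]big1 => [|j' /negbTE ne].
  by rewrite mulr1; apply: eq_bigr => i _; rewrite eqxx expr1.
by apply: big1 => i _; rewrite ne expr0.
Qed.

(** Induction on the mass off the last vertices: [tau_swap] moves one unit to the last vertex of its
    block, which preserves the block degrees. *)
Lemma tau_conc l : (\sum_v l v <= d)%N -> tau l = tau (conc (lsum l)).
Proof.
have [n] := ubnP (\sum_x l (basisv x))%N; elim: n l => // n IH l ln ld.
have [/existsP[x lx]|/existsPn l0] := boolP [exists x, 0 < l (basisv x)]%N; last first.
  have l0' j i : i != ord_max -> l (@vtx _ dd j i) = 0%N.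
    case: (unliftP ord_max i) => [i'|] ->; last by rewrite eqxx.
    rewrite lift_ord_max.
    by move=> _; have := l0 (Tagged (fun j => 'I_(dd j)) i'); rewrite /basisv /= -eqn0Ngt => /eqP.
  apply: eq_tau => -[j i]; rewrite -[existT _ j i]/(vtx i) /conc /=.
  have [e|ne] := eqVneq i ord_max; last first.
    by rewrite l0'// val_eq_ord_max (negPf ne).
  rewrite e eqxx /lsum (bigD1 ord_max)//= big1 ?addn0// => i' ne.
  exact: l0'.
pose l1 v := (l v - (v == basisv x))%N.
have l1E v : l v = (l1 v + (v == basisv x))%N.
  by rewrite /l1; case: eqP => [->|_]; rewrite ?subnK// subn0 addn0.
have sl1 : (\sum_v l v = (\sum_v l1 v).+1)%N.
  by rewrite (eq_bigr _ (fun v _ => l1E v)) big_split /= sum_delta addn1.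
have ld1 : (\sum_v l1 v < d)%N by rewrite -sl1.
pose l2 v := (l1 v + (v == vtx (@ord_max (dd (tag x)))))%N.
rewrite (eq_tau l1E) tau_swap// -/l2 IH.
- apply: eq_tau => v; rewrite /conc; case: ifP => // _.
  rewrite /l2 lsumD lsum_delta /=.
  have -> : lsum l (tag v) = lsum (fun v => l1 v + (v == basisv x))%N (tag v).
    by apply: eq_bigr => i _; rewrite -l1E.
  by rewrite lsumD lsum_delta.
- rewrite -ltnS; apply: leq_trans ln; rewrite ltnS.
  have l2x x' : (l2 (basisv x') = l1 (basisv x'))%N.
    by rewrite /l2 (negPf (basisv_neq_max _ _)) addn0.
  rewrite (eq_bigr _ (fun x' _ => l2x x')) (bigD1 x)//= [X in (_ < X)%N](bigD1 x)//=.
  rewrite -addSn leq_add//.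
    by rewrite [in X in (_ <= X)%N]l1E eqxx addn1.
  by apply: leq_sum => x' _; rewrite /l1 leq_subr.
- by rewrite /l2 big_split /= sum_delta addn1.
Qed.

Lemma tau_lsum l l' : (\sum_v l v <= d)%N -> lsum l =1 lsum l' -> tau l = tau l'.
Proof.
move=> ld e; have ld' : (\sum_v l' v <= d)%N.
  by move: ld; rewrite !sum_lsum (eq_bigr _ (fun j _ => e j)).
rewrite tau_conc// [RHS]tau_conc//; apply: eq_tau => v.
by rewrite /conc; case: ifP.
Qed.

(** * Fourier expansion of the functional over the critical points *)

Hypotheses (y_inj : forall j, injective (@y j)) (a_neq0 : forall v, av v != 0).
Hypothesis ya : forall j (i : 'I_(dd j).+1), y i ^+ (dd j).+1 = \prod_i @a j i.

Lemma proda_neq0 j : \prod_i @a j i != 0.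
Proof. by apply/prodf_neq0 => i _; exact: (a_neq0 (vtx i)). Qed.

Lemma y_neq0 j i : @y j i != 0.
Proof.
by apply: contraNneq (proda_neq0 j) => yi0; rewrite -(ya i) yi0 expr0n.
Qed.

(** The type [box] has two roles: its elements [e] are exponents 0 <= e_j <= d_j, its elements [c]
    choose a root in each block, that is, a critical point. *)
Definition wt : box -> K := boxweight y (fun e => tau (conc (fun j => e j))).

(** Inside the box this is Fourier inversion; outside, lowering some e_j by n_j divides both sides
    by prod_i a_ji = y_j^(n_j). *)
Lemma tau_conc_fourier e : (\sum_j e j <= d)%N ->
  tau (conc e) = \sum_(c : box) wt c * \prod_j y (c j) ^+ e j.
Proof.
have [n] := ubnP (\sum_j e j)%N; elim: n e => // n IH e en ed.
have [/existsP[j ej]|/existsPn ejP] := boolP [exists j, dd j < e j]%N; last first.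
  pose eb : box := [ffun j => inord (e j)].
  have ebE j : eb j = e j :> nat by rewrite ffunE inordK// ltnS leqNgt.
  have := boxweightK y_inj proda_neq0 ya (fun e => tau (conc (fun j => e j))) eb.
  have -> : tau (conc (fun j => eb j)) = tau (conc e).
    by apply: eq_tau => v; rewrite /conc ebE.
  move<-; apply: eq_bigr => c _; congr (_ * _).
  by apply: eq_bigr => j _; rewrite ebE.
pose e1 j' := (e j' - (j' == j) * (dd j).+1)%N.
have e1E j' : e j' = (e1 j' + (j' == j) * (dd j).+1)%N.
  by rewrite /e1; case: eqP => [->|_]; rewrite ?mul1n ?subnK// mul0n subn0 addn0.
have se1 : (\sum_j e j = \sum_j e1 j + (dd j).+1)%N.
  rewrite (eq_bigr _ (fun j' _ => e1E j')) big_split /=; congr (_ + _)%N.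
  by rewrite (bigD1 j)//= eqxx mul1n big1 ?addn0// => j' /negbTE ->.
(* As e_j > d_j, one unit can be placed on each of the n_j vertices of block j, ready for
   [tau_block]. *)
have -> : tau (conc e) = tau (fun v => conc e1 v + (tag v == j))%N.
  apply: tau_lsum => [|j'].
    by rewrite sum_lsum (eq_bigr _ (fun j _ => lsum_conc e j)).
  rewrite lsumD lsum_block !lsum_conc e1E.
  by case: eqP => [->|].
rewrite tau_block IH; [|lia|lia].
rewrite mulr_sumr; apply: eq_bigr => c _; rewrite mulrCA; congr (_ * _).
rewrite (bigD1 j)//= [in RHS](bigD1 j)//= e1E eqxx mul1n exprD ya.
rewrite [_ ^+ _ * _]mulrC -!mulrA; congr (_ * (_ * _)).
by apply: eq_bigr => j' /negbTE ne; rewrite e1E ne addn0.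
Qed.

Lemma tau_fourier l : (\sum_v l v <= d)%N ->
  tau l = \sum_(c : box) wt c * \prod_j y (c j) ^+ lsum l j.
Proof. by move=> ld; rewrite tau_conc// tau_conc_fourier// -sum_lsum. Qed.

(** The value of f at c, where all n_j terms X_ji of block j equal y_j. *)
Definition fval (c : box) : K := 1 - \sum_j (dd j).+1%:R * y (c j).

Lemma wt_fval_eq0 e : (\sum_j e j < d)%N ->
  \sum_(c : box) wt c * fval c * \prod_j y (c j) ^+ e j = 0.
Proof.
move=> ed.
have sc : (\sum_v conc e v < d)%N.
  by rewrite sum_lsum (eq_bigr _ (fun j _ => lsum_conc e j)).
have := tau_sum sc; rewrite tau_conc_fourier ?(ltnW ed)//.
have cE w : tau (fun v => conc e v + (v == w))%N =
    \sum_(c : box) wt c * (\prod_j y (c j) ^+ e j) * y (c (tag w)).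
  rewrite tau_fourier; last by rewrite big_split /= sum_delta addn1.
  apply: eq_bigr => c _; rewrite -mulrA; congr (_ * _).
  under eq_bigr do rewrite lsumD lsum_conc lsum_delta exprD.
  rewrite big_split /=; congr (_ * _).
  rewrite (bigD1 (tag w))//= eqxx expr1 big1 ?mulr1// => j /negbTE ->.
  by rewrite expr0.
rewrite (eq_bigr _ (fun w _ => cE w)) exchange_big /= => /eqP.
rewrite -subr_eq0 -sumrB => /eqP h; rewrite -[RHS]h; apply: eq_bigr => c _.
rewrite -mulr_sumr -mulrA [fval _ * _]mulrC mulrA /fval mulrBr mulr1.
congr (_ - _ * _).
by rewrite big_vtx; apply: eq_bigr => j _; rewrite /= sumr_const card_ord mulr_natl.
Qed.

Definition topbox : box := [ffun j => ord_max].

Lemma boxsum_lt_top (e : box) : e != topbox -> (\sum_j e j < d)%N.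
Proof.
move=> ne; have [j ej] : exists j, e j != ord_max.
  apply/existsP; rewrite -negb_forall; apply: contra ne => /forallP h.
  by apply/eqP/ffunP => j; rewrite ffunE; apply/eqP.
have lt : (e j < dd j)%N.
  by rewrite ltn_neqAle -ltnS ltn_ord andbT; apply: contra ej => /eqP h; apply/eqP/val_inj.
rewrite /dtot (bigD1 j)//= [X in (_ < X)%N](bigD1 j)//= -addSn leq_add//.
by apply: leq_sum => j' _; rewrite -ltnS.
Qed.

(** The one moment of w_c f(c) left free by F_0; the constant lambda is [topmass] divided by
    [nprod dd]. *)
Definition topmass : K := \sum_(c : box) wt c * fval c * \prod_j y (c j) ^+ dd j.

Lemma wt_fval (c : box) :
  wt c * fval c = (nprod dd)^-1 * topmass / \prod_j y (c j) ^+ dd j.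
Proof.
have top j : topbox j = dd j :> nat by rewrite ffunE.
have := box_inversion_top y_inj proda_neq0 ya (g := fun c => wt c * fval c) (top := topbox).
move=> /(_ (fun e ne => wt_fval_eq0 (boxsum_lt_top ne))) /(_ c) ->.
congr (_ * _ / _); last by apply: eq_bigr => j _; rewrite top.
by apply: eq_bigr => c' _; congr (_ * _); apply: eq_bigr => j _; rewrite top.
Qed.

(** Evaluation of t^m at the critical point c, whose coordinate t_x is fixed by X = y_j at the
    vertex [basisv x]. *)
Definition chi (c : box) (m : Lat) : K :=
  \prod_(x : Tidx) (y (c (tag x)) / av (basisv x)) ^ m x.

Lemma chiD c m m' : chi c (m + m') = chi c m * chi c m'.
Proof.
rewrite /chi -big_split; apply: eq_bigr => x _; rewrite ffunE expfzDr//.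
by rewrite mulf_neq0 ?invr_neq0 ?y_neq0.
Qed.

Lemma chi0 c : chi c 0 = 1.
Proof. by apply: big1 => x _; rewrite ffunE expr0z. Qed.

Lemma chiMn c m n : chi c (m *+ n) = chi c m ^+ n.
Proof. by elim: n => [|n IH]; rewrite ?chi0// mulrS chiD IH exprS. Qed.

Lemma chi_sum c (I : Type) (s : seq I) (F : I -> Lat) :
  chi c (\sum_(i <- s) F i) = \prod_(i <- s) chi c (F i).
Proof. exact: (big_morph _ (chiD c) (chi0 c)). Qed.

(** Immediate at basis vertices. At the last vertex of a block the character is an inverse product
    of coordinates, and y_j^(n_j) = prod_i a_ji gives the value. *)
Lemma chi_vert (c : box) v : av v * chi c (vert v) = y (c (tag v)).
Proof.
pose n j := @ord_max (dd j).
case: v => j i; rewrite -[existT _ j i]/(vtx i) /=.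
case: (unliftP ord_max i) => [i'|] ->.
  rewrite /chi (bigD1 (Tagged (fun j => 'I_(dd j)) i'))//= big1 => [|x ne].
    rewrite vertE lift_ord_max -[vtx (widen_ord _ _)]/(basisv (Tagged (fun j => 'I_(dd j)) i')).
    by rewrite eqxx (negPf (basisv_neq_max _ _)) subr0 expr1z mulr1 mulrC divfK.
  rewrite vertE lift_ord_max -[vtx (widen_ord _ _)]/(basisv (Tagged (fun j => 'I_(dd j)) i')).
  rewrite (negPf (basisv_neq_max _ _)) subr0.
  case: eqP => [|_]; last by rewrite expr0z.
  by move/basisv_inj => e; rewrite e eqxx in ne.
rewrite /chi big_Tidx (bigD1 j)//= [X in _ * (_ * X)]big1 => [|j' /negbTE ne]; last first.
  apply: big1 => i' _; rewrite vertE /basisv /= !eq_vtx [j == j']eq_sym ne /=.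
  by rewrite subr0 expr0z.
rewrite mulr1.
transitivity (av (vtx (n j)) * \prod_(i' < dd j) (av (vtx (lift ord_max i')) / y (c j))).
  congr (_ * _); apply: eq_bigr => i' _; rewrite vertE lift_ord_max /basisv /= !eq_vtx eqxx /=.
  by rewrite gtn_eqF ?eqxx// sub0r exprN1 invf_div.
rewrite prodf_div prodr_const card_ord mulrA.
have <- : \prod_i @a j i = av (vtx (n j)) * \prod_(i' < dd j) av (vtx (lift ord_max i')).
  exact: (bigD1_ord (n j)).
by rewrite -(ya (c j)) exprS mulfK// expf_neq0// y_neq0.
Qed.

Lemma chi_lpt (c : box) l :
  (\prod_v av v ^+ l v) * chi c (lpt l) = \prod_j y (c j) ^+ lsum l j.
Proof.
rewrite /lpt chi_sum -big_split -(prod_lsum (fun j => y (c j))); apply: eq_bigr => v _ /=.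
by rewrite chiMn -exprMn chi_vert.
Qed.

Lemma rho_fourier l : (\sum_v l v <= d)%N ->
  rho (lpt l) = \sum_(c : box) wt c * chi c (lpt l).
Proof.
move=> ld; have p0 : \prod_v av v ^+ l v != 0.
  by apply/prodf_neq0 => v _; rewrite expf_neq0.
apply: (mulfI p0); rewrite -/(tau l) tau_fourier// mulr_sumr.
by apply: eq_bigr => c _; rewrite -chi_lpt; ring.
Qed.

End Van.
End Functional.

(** * The toric Hessian *)

Lemma big_option (K : Type) (idx : K) (op : Monoid.com_law idx) (T : finType)
    (F : option T -> K) :
  \big[op/idx]_x F x = op (F None) (\big[op/idx]_t F (Some t)).
Proof.
have e : enum {: option T} = None :: map Some (enum T).
  by rewrite !enumT [in LHS]unlock.
by rewrite -big_enum /= e big_cons big_map big_enum.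
Qed.

Section Hessian.
Context {K : numFieldType} {r : nat} {dd : 'I_r -> nat}.
Variable a : forall j : 'I_r, 'I_(dd j).+1 -> K.

Local Notation Vidx := (Vidx dd).
Local Notation Tidx := (Tidx dd).
Local Notation Lat := (Lat dd).
Local Notation LP := (LP K dd).
Local Notation X := (option Tidx).
Local Notation box := {dffun forall j : 'I_r, 'I_(dd j).+1}.
Local Notation d := (dtot dd).

Definition termpt (p : option Vidx) : Lat := if p is Some v then vert v else 0.

Definition termcoef (p : option Vidx) : K := if p is Some v then - av a v else 1.

Definition termrow (p : option Vidx) (x : X) : K :=
  if x is Some t then (termpt p t)%:~R else 1.

Definition terms : seq (option Vidx) := None :: map Some (enum {: Vidx}).

(** M_f is the sum over the terms of f of rank-one matrices built from the vectors (1, m), with m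
    the exponent of the term and [None] the constant term. *)
Lemma MfE x y : Mf a x y =
  [seq (termcoef p * termrow p x * termrow p y, (0%N, termpt p)) | p <- terms].
Proof.
have pE : polyF a = [seq (termcoef p, (0%N, termpt p)) | p <- terms].
  by rewrite /polyF /terms /= -map_comp.
rewrite /Mf pE; case: x y => [s|] [t|]; rewrite /ltheta -?map_comp; apply: eq_map => p /=.
- by rewrite mulrAC.
- by rewrite mulr1.
- by rewrite mulr1.
- by rewrite !mulr1.
Qed.

Lemma lapply_lmul (rho : Lat -> K) (p q : LP) :
  lapply rho (lmul p q) = \sum_(x <- p) x.1 * lapply (fun m => rho (x.2.2 + m)) q.
Proof.
rewrite /lapply /lmul big_allpairs_dep; apply: eq_bigr => x _.
by rewrite mulr_sumr; apply: eq_bigr => y _; rewrite mulrA.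
Qed.

Lemma lapply_ldet (rho : Lat -> K) (B : X -> X -> LP) :
  lapply rho (ldet B) = \sum_(s : {perm X}) (-1) ^+ odd_perm s *
    lapply rho (foldr lmul lone [seq B x (s x) | x <- enum {: X}]).
Proof.
rewrite /lapply /ldet big_flatten big_map big_enum /=; apply: eq_bigr => s _.
by rewrite /lscale big_map mulr_sumr; apply: eq_bigr => x _ /=; rewrite mulrA.
Qed.

(** A word chooses one term of f for each row; lists follow the [foldr] in [ldet], and [wordfun]
    reads a word as a function of the row. *)
Fixpoint words (n : nat) : seq (seq (option Vidx)) :=
  if n is m.+1 then [seq p :: w | p <- terms, w <- words m] else [:: [::]].

Lemma wordsS n : words n.+1 = [seq p :: w | p <- terms, w <- words n].
Proof. by []. Qed.

Lemma size_words n w : w \in words n -> size w = n.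
Proof.
elim: n w => [|n IH] w; first by rewrite inE => /eqP ->.
by rewrite wordsS => /allpairsPdep[p [w' [_ /IH <- ->]]].
Qed.

Lemma lapply_foldr_lmul (rho : Lat -> K) (xs : seq X)
    (g : X -> option Vidx -> K) :
  lapply rho (foldr lmul lone
    [seq [seq (g x p, (0%N, termpt p)) | p <- terms] | x <- xs]) =
  \sum_(w <- words (size xs))
    (\prod_(z <- zip xs w) g z.1 z.2) * rho (\sum_(p <- w) termpt p).
Proof.
elim: xs rho => [|x xs IH] rho.
  by rewrite /lapply /lone /words !big_seq1 /= !big_nil.
rewrite map_cons -[foldr _ _ (_ :: _)]/(lmul _ (foldr _ _ _)) lapply_lmul.
rewrite big_map wordsS big_allpairs_dep.
apply: eq_bigr => p _; rewrite IH mulr_sumr; apply: eq_bigr => w _ /=.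
by rewrite !big_cons mulrA.
Qed.

Definition wordfun (w : seq (option Vidx)) (x : X) : option Vidx :=
  nth None w (index x (enum {: X})).

Lemma zip_wordfun w : size w = #|{: X}| ->
  zip (enum {: X}) w = [seq (x, wordfun w x) | x <- enum {: X}].
Proof.
move=> sw; have sE : size (enum {: X}) = size w by rewrite -cardE.
apply: (@eq_from_nth _ (None, None)); first by rewrite size_zip size_map sE minnn.
move=> i; rewrite size_zip sE minnn => iw.
rewrite nth_zip// (nth_map None) ?sE// /wordfun index_uniq ?sE//.
exact: enum_uniq.
Qed.

Lemma map_wordfun w : size w = #|{: X}| -> map (wordfun w) (enum {: X}) = w.
Proof.
move=> sw; have := congr1 (map snd) (zip_wordfun sw).
rewrite -map_comp => <-; apply: unzip2_zip; by rewrite sw cardE.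
Qed.

(** Multilinear expansion in the rows: once a term is chosen for row x, that row is a multiple of
    its [termrow], so what remains is a scalar determinant. *)
Lemma lapply_ldet_words (rho : Lat -> K) :
  lapply rho (ldet (Mf a)) = \sum_(w <- words #|{: X}|)
    (\prod_x (termcoef (wordfun w x) * termrow (wordfun w x) x)) *
    rho (\sum_(p <- w) termpt p) * fdet (fun x y => termrow (wordfun w x) y).
Proof.
rewrite lapply_ldet.
transitivity (\sum_(s : {perm X}) \sum_(w <- words #|{: X}|) (-1) ^+ odd_perm s *
   ((\prod_x (termcoef (wordfun w x) * termrow (wordfun w x) x *
     termrow (wordfun w x) (s x))) * rho (\sum_(p <- w) termpt p))).
  apply: eq_bigr => s _; rewrite -mulr_sumr; congr (_ * _).
  have -> : [seq Mf a x (s x) | x <- enum {: X}] =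
     [seq [seq (termcoef p * termrow p x * termrow p (s x), (0%N, termpt p))
        | p <- terms] | x <- enum {: X}].
    by apply: eq_map => x; rewrite MfE.
  rewrite (lapply_foldr_lmul _ _ (fun x p => termcoef p * termrow p x * termrow p (s x))).
  rewrite -cardE !big_seq; apply: eq_bigr => w /size_words sw; congr (_ * _).
  by rewrite zip_wordfun// big_map big_enum.
rewrite exchange_big /=; apply: eq_bigr => w _.
rewrite /fdet mulr_sumr; apply: eq_bigr => s _.
have E (s0 p q t : K) : s0 * (p * q * t) = p * t * (s0 * q) by ring.
by rewrite [\prod_x (_ * _ * _)]big_split /= E.
Qed.

Lemma sum_termpt w :
  \sum_(p <- w) termpt p = lpt (fun v => count_mem (Some v) w).
Proof.
elim: w => [|p w IH].
  by rewrite big_nil /lpt big1// => v _; rewrite mulr0n.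
rewrite big_cons IH lptD; congr (_ + _); case: p => [w0|] /=.
  by rewrite -lpt_delta; apply: eq_lpt => v; rewrite [in RHS]eq_sym.
by rewrite /lpt big1.
Qed.

Lemma sum_count_Some (w : seq (option Vidx)) :
  (\sum_v count_mem (Some v) w <= size w)%N.
Proof.
elim: w => [|p w IH]; first by rewrite big1.
rewrite /= big_split /= -add1n leq_add//; case: p => [w0|] /=; last by rewrite big1.
by rewrite -(sum_delta w0); apply: leq_sum => v _; rewrite eq_sym.
Qed.

(* [d + 1] distinct vertices must exhaust one of the blocks, whose sum is 0. *)
Lemma uniq_sum_termpt w : uniq w -> size w = d.+1 ->
  exists2 l, (\sum_v l v <= d)%N & \sum_(p <- w) termpt p = lpt l.
Proof.
move=> uw sw; rewrite sum_termpt; pose l (v : Vidx) := count_mem (Some v) w; rewrite -/l.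
have l1 v : (l v <= 1)%N by rewrite /l count_uniq_mem// leq_b1.
have ld : (\sum_v l v <= d.+1)%N by rewrite -sw sum_count_Some.
have [ld'|dl] := leqP (\sum_v l v)%N d; first by exists l.
have [j hj] : exists j, (dd j < lsum l j)%N.
  apply/existsP; apply: contraTT dl; rewrite negb_exists => /forallP h.
  by rewrite -leqNgt sum_lsum; apply: leq_sum => j _; rewrite leqNgt.
have lj i : l (@vtx _ dd j i) = 1%N.
  apply/eqP; rewrite eqn_leq l1 /= lt0n; apply: contraTneq hj => l0.
  rewrite -leqNgt /lsum (bigD1_ord i)//= l0 add0n.
  apply: leq_trans (leq_sum _ (fun k _ => l1 _)) _.
  by rewrite sum1_card card_ord.
pose l' v := (l v - (tag v == j))%N.
have l'E v : l v = (l' v + (tag v == j))%N.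
  rewrite /l' subnK//; case: v => j' i /=; case: eqP => // e; subst j'.
  by rewrite -[existT _ j i]/(vtx i) lj.
exists l'; last by rewrite (eq_lpt l'E) lptD lpt_block addr0.
move: ld; rewrite (eq_bigr _ (fun v _ => l'E v)) big_split /= => ld.
rewrite -ltnS (leq_trans _ ld)// -[X in (X < _)%N]addn0 ltn_add2l.
by rewrite (bigD1 (vtx (@ord_max (dd j))))//= eqxx.
Qed.

(** Words of length d + 1 could leave the range of agreement. A repeated term gives two equal rows
    and a zero determinant; for distinct terms [uniq_sum_termpt] brings the exponent back to degree
    at most d. *)
Lemma lapply_ldet_eq (rho rho' : Lat -> K) :
    (forall l, (\sum_v l v <= d)%N -> rho (lpt l) = rho' (lpt l)) ->
  lapply rho (ldet (Mf a)) = lapply rho' (ldet (Mf a)).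
Proof.
move=> e; rewrite !lapply_ldet_words !big_seq; apply: eq_bigr => w /size_words sw.
have [uw|nuw] := boolP (uniq w).
  have [|l ld ->] := uniq_sum_termpt uw; last by rewrite e.
  by rewrite sw card_option card_Tidx.
have /injectivePn[x1 [x2 ne e12]] : ~~ injectiveb (wordfun w).
  apply: contra nuw => /injectiveP inj; rewrite -(map_wordfun sw).
  by rewrite map_inj_uniq ?enum_uniq.
rewrite (@fdet_eqrow _ _ _ x1 x2) ?mulr0//.
- by move=> z /eqP; rewrite -addr_eq0 -mulr2n mulrn_eq0 /= => /eqP.
- by move=> t; rewrite e12.
Qed.

(** A character extends to a ring morphism on Laurent polynomials, and these commute with
    determinants. *)
Lemma lapply_chi_ldet (ch : Lat -> K) (B : X -> X -> LP) :
    ch 0 = 1 -> (forall m m', ch (m + m') = ch m * ch m') ->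
  lapply ch (ldet B) = fdet (fun x y => lapply ch (B x y)).
Proof.
move=> ch0 chD; rewrite lapply_ldet; apply: eq_bigr => s _; congr (_ * _).
rewrite -big_enum /=; elim: (enum _) => [|x xs IH] /=.
  by rewrite big_nil /lapply big_seq1 /= mul1r.
rewrite big_cons lapply_lmul -IH {2}/lapply mulr_suml; apply: eq_bigr => z _.
rewrite -mulrA; congr (_ * _); rewrite /lapply mulr_sumr; apply: eq_bigr => q _.
by rewrite chD mulrCA.
Qed.

Section AtCritical.
Variable y : forall j : 'I_r, 'I_(dd j).+1 -> K.
Hypothesis a_neq0 : forall v, av a v != 0.
Hypothesis ya : forall j (i : 'I_(dd j).+1), y i ^+ (dd j).+1 = \prod_i @a j i.

Definition critdiag (c : box) (x : X) : K :=
  if x is Some t then - y (c (tag t)) else fval y c.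

Definition blockrow (x : X) (j : 'I_r) : K :=
  if x is Some t then (tag t == j)%:R else 0.

(** At c the derivatives f_i vanish, leaving f(c) in the corner, and the block of index j is -y_j
    times the identity plus the all-ones matrix. *)
Lemma lapply_chi_Mf (c : box) x z :
  lapply (chi a y c) (Mf a x z) =
  critdiag c x * ((x == z)%:R + \sum_j blockrow x j * blockrow z j).
Proof.
rewrite MfE /lapply big_map /terms big_cons big_map big_enum /= chi0 mulr1 mul1r.
have -> : \sum_v termcoef (Some v) * termrow (Some v) x * termrow (Some v) z *
    chi a y c (vert v) = - \sum_v y (c (tag v)) * termrow (Some v) x * termrow (Some v) z.
  by rewrite -sumrN; apply: eq_bigr => v _; rewrite /= -(chi_vert a_neq0 ya c v); ring.
case: x z => [s|] [t|] /=.
- rewrite ffunE mul0r add0r.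
  rewrite (sum_vert (fun v => y (c (tag v)) * (vert v s)%:~R)) !vertE /=.
  rewrite (inj_eq (@basisv_inj _ _)) (negPf (basisv_neq_max _ _)).
  rewrite [vtx _ == basisv s]eq_sym (negPf (basisv_neq_max _ _)) eq_vtx /=.
  have -> : (Some s == Some t :> option Tidx) = (t == s) by rewrite eq_sym.
  rewrite (bigD1 (tag t))//= eqxx [X in _ * (_ + (_ + X))]big1 => [|j /negbTE ne]; last first.
    by rewrite [tag t == j]eq_sym ne mulr0.
  rewrite mulr1 addr0 [tag s == tag t]eq_sym.
  case: (eqVneq (tag t) (tag s)) => [->|ne] /=.
    by rewrite eqxx; case: (t == s); rewrite /= ?subr0; ring.
  have -> : (t == s) = false by apply: contraNF ne => /eqP ->.
  by rewrite !(subrr, mulr0n, subr0, mulr0z, mulr0, addr0, oppr0).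
- under eq_bigr do rewrite mulr1.
  rewrite sum_vert /= ffunE subrr mul0r subr0 big1 ?addr0 ?mulr0// => j _.
  by rewrite mulr0.
- under eq_bigr do rewrite mulr1.
  rewrite ffunE sum_vert /= subrr mul1r subr0 big1 ?addr0 ?mulr0// => j _.
  by rewrite mul0r.
- rewrite mulr1 [X in _ * (_ + X)]big1 => [|j _]; last by rewrite mul0r.
  rewrite addr0 mulr1 /fval; congr (_ - _).
  under eq_bigr do rewrite !mulr1.
  by rewrite big_vtx; apply: eq_bigr => j _; rewrite /= sumr_const card_ord mulr_natl.
Qed.

Lemma fdet_chi_Mf (c : box) :
  fdet (fun x z => lapply (chi a y c) (Mf a x z)) =
  fval y c * (-1) ^+ d * (\prod_j y (c j) ^+ dd j) * nprod dd.
Proof.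
rewrite fdetE.
pose D := diag_mx (\row_(i < #|{: X}|) critdiag c (enum_val i)).
pose U := \matrix_(i < #|{: X}|, j < r) blockrow (enum_val i) j.
have -> : \matrix_(i, i') lapply (chi a y c) (Mf a (enum_val i) (enum_val i')) =
    D *m (1%:M + U *m U^T).
  apply/matrixP => i i'; rewrite mul_diag_mx !mxE lapply_chi_Mf.
  rewrite (inj_eq enum_val_inj); congr (_ * (_ + _)).
  by apply: eq_bigr => j _; rewrite !mxE.
have Tsig (F : 'I_r -> K) : \prod_(x : Tidx) F (tag x) = \prod_j F j ^+ dd j.
  by rewrite big_Tidx; apply: eq_bigr => j _; rewrite /= prodr_const card_ord.
rewrite det_mulmx sylvester_det det_diag.
have -> : 1%:M + U^T *m U = diag_mx (\row_j (dd j).+1%:R).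
  apply/matrixP => j j'; rewrite !mxE.
  under eq_bigr do rewrite !mxE.
  transitivity ((j == j')%:R + \sum_x blockrow x j * blockrow x j').
    congr (_ + _); rewrite [RHS](reindex (fun i : 'I_#|{: X}| => enum_val i))//.
    exact/onW_bij/enum_val_bij.
  rewrite big_option /= mul0r add0r.
  have [<-|ne] := eqVneq j j'; last first.
    rewrite mulr0n add0r big1// => x _; case: eqP => [->|]; last by rewrite mul0r.
    by rewrite (negPf ne) mulr0.
  rewrite mulr1n -nat1r; congr (_ + _).
  rewrite big_Tidx (bigD1 j)//= [X in _ + X]big1 => [|j1 /negbTE ne1].
    by rewrite eqxx mulr1 sumr_const card_ord addr0.
  by rewrite big1// => i _; rewrite ne1 mul0r.
rewrite det_diag /nprod.
under [X in _ * X]eq_bigr do rewrite mxE.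
congr (_ * _).
transitivity (\prod_x critdiag c x).
  rewrite [RHS](reindex (fun i : 'I_#|{: X}| => enum_val i)) /=; last exact/onW_bij/enum_val_bij.
  by apply: eq_bigr => i _; rewrite mxE.
rewrite big_option /= -mulrA; congr (_ * _).
rewrite (Tsig (fun j => - y (c j))).
under eq_bigr do rewrite exprNn.
by rewrite big_split /= -expr_sum.
Qed.

End AtCritical.
End Hessian.

(** * The trace formula *)

(** Summing w_c times the value of H'_f at c gives (-1)^d [nprod dd] [topmass]; the normalisation
    makes this Vol(Delta), which is [nprod dd] as well. *)
Lemma topmass_toric_residue (K : numFieldType) (r : nat) (dd : 'I_r -> nat)
    (a : forall j : 'I_r, 'I_(dd j).+1 -> K)
    (y : forall j : 'I_r, 'I_(dd j).+1 -> K) (V : rat) (rho : Lat dd -> K) :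
    (0 < r)%N -> (0 < dtot dd)%N -> EuclVolDelta dd V -> IsToricResidue a V rho ->
    (forall j, injective (y j)) -> (forall v, av a v != 0) ->
    (forall j i, y j i ^+ (dd j).+1 = \prod_i a j i) ->
  topmass a y rho = (-1) ^+ dtot dd.
Proof.
move=> r0 d0 hV [_ [van hH]] y_inj a0 ya.
have n0 := @nprod_neq0 K r dd.
apply: (mulIf n0); apply: (mulfI (_ : (-1) ^+ dtot dd != 0 :> K)).
  by rewrite signr_eq0.
rewrite [RHS]mulrA -expr2 sqrr_sign mul1r.
have nE : nprod dd = ((dtot dd)`!)%:R * ratr V :> K.
  have := congr1 (ratr (R := K)) (EuclVolDeltaE r0 hV).
  by rewrite rmorphM /= !ratr_nat => ->; rewrite natr_prod.
rewrite [RHS]nE -hH /Hprime.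
have -> : lapply rho (lt0pow (dtot dd) (ldet (Mf a))) = lapply rho (ldet (Mf a)).
  by rewrite /lapply big_map.
rewrite (lapply_ldet_eq a (rho' := fun m => \sum_c wt a y rho c * chi a y c m)
  (rho_fourier r0 d0 van y_inj a0 ya)).
have -> : lapply (fun m => \sum_c wt a y rho c * chi a y c m) (ldet (Mf a)) =
    \sum_c wt a y rho c * lapply (chi a y c) (ldet (Mf a)).
  rewrite /lapply; under eq_bigr do rewrite mulr_sumr.
  rewrite exchange_big /=; apply: eq_bigr => c _; rewrite mulr_sumr.
  by apply: eq_bigr => x _; rewrite mulrCA.
rewrite /topmass mulr_suml mulr_sumr; apply: eq_bigr => c _.
rewrite (lapply_chi_ldet _ (chi0 _ _ c) (chiD a0 ya c)) (fdet_chi_Mf a0 ya).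
have E (s w f p n : K) : s * (w * f * p * n) = w * (f * s * p * n) by ring.
exact: E.
Qed.

(** The contribution of one block after y = z / n; the exponents are integers because k may exceed
    d. *)
Lemma trace_factor (K : fieldType) (n z : K) (d k : nat) : n != 0 -> z != 0 ->
  n^-1 * ((z / n) ^+ k / (z / n) ^+ d) =
  n ^ (d%:Z - k%:Z - 1) * (z ^ (d%:Z - k%:Z))^-1.
Proof.
move=> n0 z0; rewrite !expfzDr// -!invr_expz -!exprnP expr1 !expr_div_n.
by field; rewrite n0 !expf_neq0.
Qed.

Lemma toric_residue_trace (K : numFieldType) (r : nat) (dd : 'I_r -> nat)
    (a : forall j : 'I_r, 'I_(dd j).+1 -> K)
    (k : forall j : 'I_r, 'I_(dd j).+1 -> nat)
    (V : rat) (rho : Lat dd -> K) (zs : forall j : 'I_r, 'I_(dd j).+1 -> K) :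
    (0 < r)%N -> (forall j, (0 < dd j)%N) ->
    (\sum_(j < r) \sum_(i < (dd j).+1) k j i)%N = dtot dd ->
    EuclVolDelta dd V -> IsToricResidue a V rho ->
    (forall j, injective (zs j)) ->
    (forall j i, zs j i ^+ (dd j).+1 = uvar a j) ->
    (forall c : {dffun forall j : 'I_r, 'I_(dd j).+1},
       1 - \sum_(j < r) zs j (c j) != 0) ->
  Rmono a k rho =
    (\prod_(j < r) ((dd j).+1)%:R ^ ((dd j)%:Z - (\sum_(i < (dd j).+1) k j i)%:Z - 1)) *
    \sum_(c : {dffun forall j : 'I_r, 'I_(dd j).+1})
      ((\prod_(j < r) zs j (c j) ^ ((dd j)%:Z - (\sum_(i < (dd j).+1) k j i)%:Z))
        * (1 - \sum_(j < r) zs j (c j)))^-1.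
Proof.
move=> r0 hd hk hV hrho zinj zroot zden.
have n0 j : (dd j).+1%:R != 0 :> K by rewrite pnatr_eq0.
(* If u_j were 0, all its n_j >= 2 listed roots would be 0, against injectivity. *)
have u0 j : uvar a j != 0.
  apply/eqP => uj0; have z0 i : zs j i = 0.
    by apply/eqP; have := zroot j i; rewrite uj0 => /eqP; rewrite expf_eq0.
  have := zinj j ord0 ord_max; rewrite !z0 => /(_ erefl) /(congr1 val) /= e.
  by have := hd j; rewrite -e.
have a0 v : av a v != 0.
  apply: contraNneq (u0 (tag v)) => av0.
  by rewrite /uvar (bigD1 (tagged v))//= -/(av a v) av0 mul0r mulr0.
have z0 j i : zs j i != 0.
  by apply: contraNneq (u0 j) => zi0; rewrite -(zroot j i) zi0 expr0n.
pose y j i := zs j i / (dd j).+1%:R.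
have y_inj j : injective (y j).
  by move=> i i' /(mulIf (invr_neq0 (n0 j))) /zinj.
have ya j i : y j i ^+ (dd j).+1 = \prod_i a j i.
  by rewrite /y expr_div_n zroot /uvar mulrAC divff ?mul1r// expf_neq0.
have d0 : (0 < dtot dd)%N.
  by rewrite /dtot (bigD1 (Ordinal r0))//= addn_gt0 hd.
have van := hrho.2.1.
have fE (c : {dffun forall j : 'I_r, 'I_(dd j).+1}) :
    fval y c = 1 - \sum_j zs j (c j).
  by rewrite /fval; congr (1 - _); apply: eq_bigr => j _; rewrite mulrC divfK.
pose l (v : Vidx dd) := k (tag v) (tagged v).
have -> : Rmono a k rho = (-1) ^+ dtot dd * tau a rho l.
  by rewrite /Rmono /lapply big_seq1 /=; congr (_ * (_ * rho _)).
have ld : (\sum_v l v <= dtot dd)%N by rewrite big_vtx -hk.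
rewrite (tau_fourier r0 d0 van y_inj a0 ya ld) !mulr_sumr; apply: eq_bigr => c _.
(* This is [wt_fval] divided by f(c), which is nonzero by [zden]. *)
have -> : wt a y rho c = (nprod dd)^-1 * (-1) ^+ dtot dd /
    (\prod_j y j (c j) ^+ dd j) / fval y c.
  rewrite -(topmass_toric_residue r0 d0 hV hrho y_inj a0 ya).
  by rewrite -(wt_fval r0 d0 van y_inj a0 ya) mulfK// fE.
rewrite fE [in RHS]invfM [RHS]mulrA -[in RHS]prodfV -[in RHS]big_split /=.
rewrite -(eq_bigr _ (fun j _ => trace_factor (dd j) (lsum l j) (n0 j) (z0 j (c j)))).
rewrite big_split /= prodf_div prodfV.
have E (s n p f q : K) : s ^+ 2 = 1 -> s * (n * s * p * f * q) = n * (q * p) * f.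
  by move=> s2; rewrite -[RHS]mul1r -s2; ring.
exact/E/sqrr_sign.
Qed.

Theorem mainTheorem10 (R : realType) (r : nat) (dd : 'I_r -> nat)
  (hr : (0 < r)%N) (hd : forall j, (0 < dd j)%N)
  (a : forall j : 'I_r, 'I_(dd j).+1 -> R[i])
  (k : forall j : 'I_r, 'I_(dd j).+1 -> nat)
  (hk : (\sum_(j < r) \sum_(i < (dd j).+1) k j i)%N = dtot dd)
  (hreg : DeltaRegular a)
  (V : rat) (hV : EuclVolDelta dd V)
  (rho : Lat dd -> R[i]) (hrho : IsToricResidue a V rho)
  (zs : forall j : 'I_r, 'I_(dd j).+1 -> R[i])
  (hzinj : forall j, injective (zs j))
  (hzroot : forall j i, zs j i ^+ (dd j).+1 = uvar a j)
  (hzden : forall c : {dffun forall j : 'I_r, 'I_(dd j).+1},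
             1 - \sum_(j < r) zs j (c j) != 0) :
  Rmono a k rho =
    (\prod_(j < r) ((dd j).+1)%:R ^ ((dd j)%:Z - (\sum_(i < (dd j).+1) k j i)%:Z - 1)) *
    \sum_(c : {dffun forall j : 'I_r, 'I_(dd j).+1})
      ((\prod_(j < r) zs j (c j) ^ ((dd j)%:Z - (\sum_(i < (dd j).+1) k j i)%:Z))
        * (1 - \sum_(j < r) zs j (c j)))^-1.
Proof.
exact: (toric_residue_trace hr hd hk hV hrho hzinj hzroot hzden).
Qed.
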